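(* Let $q>1$ and let $\sigma$ be a nonnegative Radon measure on $M$. Assume that there is a constant $C_0>0$ such that the volume doubling condition $\mu(B(x,2r))\le C_0\,\mu(B(x,r))$ holds for all $x\in M$ and $r>0$, and that $$G(x,y)\approx \int_{d(x,y)}^{+\infty}\frac{t\,dt}{\mu(B(x,t))},\quad x,y\in M.$$ Then the integral inequality $$u(x)\ge \int_M G(x,y)\,[u(y)]^q\,d\sigma(y),\quad x\in M,$$ has a positive solution $u$ if and only if there exist $o\in M$, $r_0>0$ and $C>0$ such that the following two conditions hold: $$\text{(i)}\quad \int_{r_0}^{+\infty}\left[\int_r^{+\infty}\frac{t\,dt}{\mu(B(o,t))}\right]^{q-1}\frac{\sigma(B(o,r))}{\mu(B(o,r))}\,r\,dr<\infty,$$ and $$\text{(ii)}\quad \sup_{x\in B(o,r)}\left[\int_0^r\frac{\sigma(B(x,s))}{\mu(B(x,s))}\,s\,ds\right]\left[\int_r^{+\infty}\frac{t\,dt}{\mu(B(o,t))}\right]^{q-1}\le C\quad\text{for all } r>r_0.$$ Moreover, if the integral inequality has a positive solution, then both (i) and (ii) hold for all $o\in M$ and $r_0>0$, with a constant $C=C(o,r_0)$ in (ii).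
   Context: $M$ is a connected complete non-compact Riemannian manifold with Riemannian measure $\mu$, geodesic distance $d$, geodesic balls $B(x,r)=\{y\in M: d(x,y)<r\}$, and Laplace-Beltrami operator $\Delta$. $M$ is assumed non-parabolic, i.e. $\Delta$ has a positive finite Green function; $G(x,y)$ denotes the minimal (positive) Green function of $\Delta$ on $M$ (finite for $x\neq y$). In particular $\int_{r_0}^{+\infty}\frac{t\,dt}{\mu(B(o,t))}<\infty$ for all $o\in M$, $r_0>0$. The sign $\approx$ means that the ratio of the left- and right-hand sides is bounded from above and below by two positive constants (independent of $x,y$). A solution of the integral inequality is a non-negative lower semicontinuous function $u:M\to[0,\infty)$ satisfying it for all $x\in M$; it is positive if $u>0$ on $M$. *)

(* Defs.v *)
From HB Require Import structures.
From mathcomp Require Import all_boot all_order all_algebra.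
From mathcomp Require Import all_classical all_reals all_analysis.
Set Implicit Arguments.
Unset Strict Implicit.
Unset Printing Implicit Defensive.
Import Order.TTheory GRing.Theory Num.Theory.
Import numFieldNormedType.Exports.

Local Open Scope classical_set_scope.
Local Open Scope ring_scope.

(* [Complete] includes a base point, which only excludes the empty space. *)
#[short(type="completeMetricType")]
HB.structure Definition CompleteMetric (K : numDomainType) :=
  { M of Complete M & Metric K M }.

Section calculus.
Context {R : realType}.

Definition partial n (V : normedModType R) (a : 'I_n) (f : 'rV[R]_n -> V) :
    'rV[R]_n -> V :=
  fun p => 'D_(delta_mx 0 a) f p.

(* C^oo on U (meant for open U): all iterated partial derivatives exist and
   are continuous at every point of U. *)
Definition smooth_on n (V : normedModType R) (U : set 'rV[R]_n)
    (f : 'rV[R]_n -> V) : Prop :=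
  forall (s : seq 'I_n) p, U p ->
    let h := foldr (@partial n V) f s in
    {for p, continuous h} /\ forall a, derivable h p (delta_mx 0 a).

(* Integral over R^n of a nonnegative Borel function with respect to the
   n-dimensional Lebesgue measure, as an iterated integral (Tonelli). *)
Fixpoint integral_rV n : ('rV[R]_n -> \bar R) -> \bar R :=
  match n with
  | 0 => fun f => f 0
  | m.+1 => fun f => (\int[lebesgue_measure]_t
      integral_rV (fun v : 'rV[R]_m => f (row_mx (t%:M : 'rV[R]_1) v)))%E
  end.

End calculus.

(* A smooth atlas on M together with a smooth Riemannian metric tensor.  The
   topology of the manifold is that of M; [param i] inverts [coord i], and
   [gram i p] is the Gram matrix of the metric at the point of coordinates p.
   The Jacobian matrix acts on row vectors: 'd f p v = v *m 'J f p. *)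
Record riemannian (R : realType) (n : nat) (M : completeMetricType R) := Riemannian {
  chart : Type ;
  dom : chart -> set M ;
  coord : chart -> M -> 'rV[R]_n ;
  param : chart -> 'rV[R]_n -> M ;
  chart_at : M -> chart ;
  gram : chart -> 'rV[R]_n -> 'M[R]_n ;
  dom_open : forall i, open (dom i) ;
  codom_open : forall i, open (coord i @` dom i) ;
  coordK : forall i x, dom i x -> param i (coord i x) = x ;
  coord_continuous : forall i x, dom i x -> {for x, continuous (coord i)} ;
  param_continuous : forall i p, (coord i @` dom i) p ->
    {for p, continuous (param i)} ;
  mem_chart_at : forall x, dom (chart_at x) x ;
  transition_smooth : forall i j,
    smooth_on (coord i @` (dom i `&` dom j)) (coord j \o param i) ;
  gram_smooth : forall i a b,
    smooth_on (coord i @` dom i) (fun p => gram i p a b : R^o) ;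
  gram_sym : forall i p, (coord i @` dom i) p -> (gram i p)^T = gram i p ;
  gram_posdef : forall i p (v : 'rV[R]_n), (coord i @` dom i) p -> v != 0 ->
    0 < (v *m gram i p *m v^T) 0 0 ;
  gram_compat : forall i j p, (coord i @` (dom i `&` dom j)) p ->
    let tau := coord j \o param i in
    gram i p = 'J tau p *m gram j (tau p) *m ('J tau p)^T
}.

Definition borel (T : ptopologicalType) := g_sigma_algebraType (@open T).

Section riemannian_geometry.
Context {R : realType} {n : nat} {M : completeMetricType R} (g : riemannian n M).

Definition speed (c : R -> M) (t : R) : R :=
  let i := chart_at g (c t) in
  let v := derive1 (coord i \o c) t in
  Num.sqrt ((v *m gram i (coord i (c t)) *m v^T) 0 0).

Definition C1_curve (c : R -> M) : Prop :=
  forall t, t \in `[0, 1] ->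
    let f := coord (chart_at g (c t)) \o c in
    [/\ {for t, continuous c},
        \forall s \near t, derivable f s 1
      & {for t, continuous (derive1 f)}].

Definition curve_length (c : R -> M) : \bar R :=
  (\int[lebesgue_measure]_(t in `[0%R, 1%R]) (speed c t)%:E)%E.

(* The distance of M is the Riemannian one.  C^1 curves may have zero speed,
   so they give the same infimum as piecewise C^1 curves. *)
Definition geodesic_distance : Prop :=
  forall x y : M, (mdist x y)%:E =
    ereal_inf [set curve_length c | c in
                [set c | [/\ C1_curve c, c 0 = x & c 1 = y]]].

Definition density (i : chart g) (p : 'rV[R]_n) : R :=
  Num.sqrt (\det (gram i p)).

Definition riemannian_measure (mu : {measure set (borel M) -> \bar R}) : Prop :=
  forall (i : chart g) (A : set (borel M)), measurable A -> A `<=` dom i ->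
    mu A = integral_rV
      (fun p => (density i p * \1_(coord i @` (A : set M)) p)%:E).

Definition smooth_function (phi : M -> R) : Prop :=
  forall i : chart g, smooth_on (coord i @` dom i) (phi \o param i : _ -> R^o).

Definition test_function (phi : M -> R) : Prop :=
  smooth_function phi /\ compact (closure [set x | phi x != 0]).

(* (det g)^(-1/2) sum_{a,b} d_a ((det g)^(1/2) g^{ab} d_b phi) *)
Definition laplace_beltrami (phi : M -> R) (x : M) : R :=
  let i := chart_at g x in
  let f : 'rV[R]_n -> R^o := phi \o param i in
  let flux a : 'rV[R]_n -> R^o := fun p =>
    density i p * \sum_b invmx (gram i p) a b * partial b f p in
  (density i (coord i x))^-1 * \sum_a partial a (flux a) (coord i x).

Variable mu : {measure set (borel M) -> \bar R}.

(* Positive fundamental solution of the Laplace-Beltrami operator: for all y,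
   - Laplacian (G(., y)) = delta_y in the sense of distributions.  Continuity
   into [0, +oo] fixes the values of G, including those on the diagonal. *)
Definition green_function (G : M -> M -> \bar R) : Prop :=
  forall y, [/\ forall x, (0 < G x y)%E,
    forall x, x != y -> (G x y < +oo)%E,
    continuous (G ^~ y),
    forall K : set M, compact K ->
      mu.-integrable (K : set (borel M)) (G ^~ y : borel M -> \bar R)
  & forall phi, test_function phi ->
      (\int[mu]_(x in [set: borel M]) (G x y * (- laplace_beltrami phi x)%:E))%E
      = (phi y)%:E].

Definition non_parabolic : Prop := exists G, green_function G.

Definition minimal_green_function (G : M -> M -> \bar R) : Prop :=
  green_function G /\
  forall G', green_function G' -> forall x y, (G x y <= G' x y)%E.

End riemannian_geometry.

Section metric_measure.
Context {R : realType} {M : completeMetricType R}.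
Implicit Types mu sigma : {measure set (borel M) -> \bar R}.

Definition radon sigma : Prop :=
  (forall K : set M, compact K -> (sigma K < +oo)%E) /\
  forall A : set (borel M), measurable A ->
    sigma A = ereal_sup [set sigma K | K in
                [set K : set M | compact K /\ K `<=` (A : set M)]].

Local Open Scope ereal_scope.

Definition volume_doubling mu : Prop :=
  exists2 C0 : R, (0 < C0)%R & forall (x : M) (r : R), (0 < r)%R ->
    mu (ball x (2 * r)%R) <= C0%:E * mu (ball x r).

Definition tail mu (x : M) (r : R) : \bar R :=
  \int[lebesgue_measure]_(t in `]r, +oo[) (t%:E / mu (ball x t)).

Definition green_estimate mu (G : M -> M -> \bar R) : Prop :=
  exists c1 c2 : R, [/\ (0 < c1)%R, (0 < c2)%R &
    forall x y : M, c1%:E * tail mu x (mdist x y) <= G x y /\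
                    G x y <= c2%:E * tail mu x (mdist x y)].

Definition positive_solution (G : M -> M -> \bar R) sigma (q : R)
    (u : M -> R) : Prop :=
  [/\ forall x, (0 < u x)%R,
      lower_semicontinuous (fun x => (u x)%:E)
    & forall x, (u x)%:E >=
        \int[sigma]_(y in [set: borel M]) (G x y * ((u y) `^ q)%:E)].

Definition condition_i mu sigma (q : R) (o : M) (r0 : R) : Prop :=
  \int[lebesgue_measure]_(r in `]r0, +oo[)
    (poweR (tail mu o r) (q - 1)
     * (sigma (ball o r) / mu (ball o r)) * r%:E) < +oo.

Definition condition_ii mu sigma (q : R) (o : M) (r0 C : R) : Prop :=
  forall r : R, (r0 < r)%R ->
    ereal_sup [set \int[lebesgue_measure]_(s in `]0%R, r[)
                     (sigma (ball x s) / mu (ball x s) * s%:E)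
              | x in ball o r]
    * poweR (tail mu o r) (q - 1) <= C%:E.

End metric_measure.

(* Main.v *)
From HB Require Import structures.
Require Import Defs.
From mathcomp Require Import all_boot all_order all_algebra.
From mathcomp Require Import all_classical all_reals all_analysis.
From mathcomp Require Import measurable_realfun ring lra.
Set Implicit Arguments.
Unset Strict Implicit.
Unset Printing Implicit Defensive.
Import Order.TTheory GRing.Theory Num.Theory.
Import numFieldNormedType.Exports.
Local Open Scope classical_set_scope.
Local Open Scope ring_scope.

(** The Green function enters only through [G x y ~ tail x (d x y)], so the
    problem becomes one about a radial kernel on a metric space with a
    doubling measure; write [tau = tail o] and [m_x] for the measure
    [t dt / mu (B (x, t))], so that [tail x r = m_x (]r, oo[)].

    Necessity: let [N] be the mass of [u^q sigma] on balls around [x].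
    Splitting [tail] along the radii [s_k = 2^k s], one gets [u >= c F_k] on
    [B (x, s_k)], where
    [F_k = \sum_(k <= j < m) N_j (tail s_j - tail s_(j+1)) + N_m tail s_m],
    hence [sigma (B_k) <= C N_k F_k^(-q)]; then
    [sigma (B_k) (tail s_k - tail s_(k+1)) <= C (F_k - F_(k+1)) F_k^(-q)],
    and the right-hand sides telescope by convexity of [t^(1-q)].  This bounds
    the integral in (ii) by [C (N_m tail s_m)^(1-q)].  Likewise, on the shells
    around [o],
    [sigma (B_(k+1) \ B_k) tau_(k+1)^q <= C (N_(k+1) - N_k) N_(k+1)^(-q)]
    telescopes, and summation by parts gives (i).

    Sufficiency: with [h y = tau (max (d o y) r0)], condition (i) and Tonelli
    give [\int h^q d sigma < oo].  If [d x y] is at least half of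
    [r = max (d o x) r0], then [tail x (d x y) <= C h x]; otherwise
    [h y <= C h x], and [tail x (d x y)] exceeds [m_x (]d x y, r])] by at most
    [C h x].  By (ii) the integral of [m_x (]d x y, r])] against [sigma] is at
    most [C (h x)^(1-q)].  Therefore [\int tail x (d x y) (h y)^q <= C h x], and a
    small multiple of [min 1 (G . o)], which is comparable to [h], is a
    solution. *)

(** * Convexity and monotonicity of real powers *)

Section power_inequalities.
Context {R : realType}.

(** Tangent line at [a] of the convex function t^(-p): with x = b / a, x^(-p) = exp (-p ln x) >= 1 -
    p ln x >= 1 + p (1 - x). This is what makes the sums of the necessity part telescope. *)
Lemma powR_lt0_decrement (a b p : R) : 0 < p -> 0 < b -> b <= a ->
  (a - b) * a `^ (- (p + 1)) <= p^-1 * (b `^ (- p) - a `^ (- p)).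
Proof.
move=> p0 b0 ba; have a0 : 0 < a by exact: lt_le_trans ba.
set x := b / a; have x0 : 0 < x by rewrite divr_gt0.
have key : 1 + p * (1 - x) <= x `^ (- p).
  rewrite /powR gt_eqF//; apply: le_trans (expR_ge1Dx _).
  rewrite lerD2l mulNr -mulrN ler_pM2l// lerNr opprB.
  have := @le_ln1Dx R (x - 1); rewrite (_ : 1 + (x - 1) = x); last by ring.
  apply.
  by rewrite ltrBDr addNr.
have -> : b = x * a by rewrite /x divfK// gt_eqF.
rewrite powRM ?(ltW x0) ?(ltW a0)//.
have -> : a `^ (- (p + 1)) = a `^ (- p) / a.
  by rewrite opprD powRD ?(gt_eqF a0) ?implybT// powR_inv1// ltW.
rewrite -subr_ge0.
have -> : p^-1 * (x `^ (- p) * a `^ (- p) - a `^ (- p)) -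
    (a - x * a) * (a `^ (- p) / a) =
    p^-1 * a `^ (- p) * (x `^ (- p) - (1 + p * (1 - x))).
  by field; rewrite !gt_eqF.
by rewrite mulr_ge0// ?mulr_ge0 ?invr_ge0 ?(ltW p0) ?powR_ge0// subr_ge0.
Qed.

Lemma le_powR2r (a b p : R) : 0 <= p -> 0 <= a -> a <= b -> a `^ p <= b `^ p.
Proof. by move=> p0 a0 ab; apply: ge0_ler_powR => //; rewrite nnegrE (le_trans a0). Qed.

End power_inequalities.

(** * Monotone functions and integrals over intervals *)

Section measure_on_halfline.
Context {R : realType}.
Local Open Scope ereal_scope.

Lemma nondecreasing_emeasurable (f : R -> \bar R) :
  {homo f : x y / (x <= y)%R >-> x <= y} -> measurable_fun setT f.
Proof.
move=> fnd; apply: (measurability _ (ErealGenOInfty.measurableE R)).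
move=> /= _ [_ [a ->]] <-; apply: measurableI => //.
apply: is_interval_measurable => s t /=; rewrite !in_itv/= !andbT => fs ft r.
by move=> /andP[sr rt]; rewrite !in_itv/= ?andbT (lt_le_trans fs)// fnd.
Qed.

(** The upper end [e] is an arbitrary interval bound, so that one statement serves half-lines and
    bounded intervals alike. *)
Lemma ge0_integral_itv_split (a b : R) (e : itv_bound R) (f : R -> \bar R) :
  (a <= b)%R -> (BRight b <= e)%O ->
  measurable_fun [set` Interval (BRight a) e] f ->
  (forall t, (a < t)%R -> 0 <= f t) ->
  \int[lebesgue_measure]_(t in [set` Interval (BRight a) e]) f t =
  \int[lebesgue_measure]_(t in `]a, b]) f t +
  \int[lebesgue_measure]_(t in [set` Interval (BRight b) e]) f t.
Proof.
move=> ab be mf f0.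
have U : [set` Interval (BRight a) e] = `]a, b] `|` [set` Interval (BRight b) e].
  by rewrite -itv_bndbnd_setU ?bnd_simp.
rewrite U ge0_integral_setU; first by [].
- exact: measurable_itv.
- exact: measurable_itv.
- by rewrite -U.
- move=> t; rewrite -U /= => h; apply: f0.
  by move: h; rewrite itv_boundlr bnd_simp => /andP[].
- rewrite disj_set2E; apply/eqP/seteqP; split=> // t /= [].
  by rewrite !itv_boundlr !bnd_simp => /andP[_ tb] /andP[]; rewrite ltNge tb.
Qed.

End measure_on_halfline.

(** * Comparison and exhaustion for non-negative integrands *)

Section integral_bounds.
Local Open Scope ereal_scope.
Context d (T : measurableType d) (R : realType) (m : {measure set T -> \bar R}).

(** Valid for arbitrary functions, since the integral of a non-negative function is a supremum over
    the simple functions below it. *)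
Lemma ge0_le_integral_any (D : set T) (f g : T -> \bar R) :
  (forall x, D x -> 0 <= f x) -> (forall x, D x -> f x <= g x) ->
  \int[m]_(x in D) f x <= \int[m]_(x in D) g x.
Proof.
move=> f0 fg; rewrite ge0_integralE//.
rewrite ge0_integralE; last by move=> x Dx; exact: le_trans (f0 _ Dx) (fg _ Dx).
apply: le_ereal_sup => _ /= [h hf <-]; exists h => // x.
apply: (le_trans (hf x)); rewrite !patchE; case: ifPn => // xD.
by apply: fg; rewrite inE in xD.
Qed.

(** Monotone convergence, in the form used to exhaust []0, r]] and half-lines by dyadic
    intervals. *)
Lemma ge0_integral_bigcup_le (F : (set T)^nat) (f : T -> \bar R) (B : \bar R) :
  nondecreasing_seq F -> (forall n, measurable (F n)) ->
  (forall n, measurable_fun (F n) f) -> (forall n x, F n x -> 0 <= f x) ->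
  (forall n, \int[m]_(x in F n) f x <= B) ->
  \int[m]_(x in \bigcup_n F n) f x <= B.
Proof.
move=> ndF mF mf f0 fB.
have /cvg_lim <- // := ge0_nondecreasing_set_cvg_integral (mu := m) ndF mF mf f0.
apply: lime_le; last by exact: nearW.
by apply/cvg_ex; eexists; exact: ge0_nondecreasing_set_cvg_integral.
Qed.

End integral_bounds.

(** * Borel sets and functions on a metric space *)

Section metric_borel.
Context {R : realType} {M : completeMetricType R}.
Implicit Types (x y z : M) (r : R).

Lemma in_ball x r y : ball x r y = (mdist x y < r) :> Prop.
Proof. by rewrite ballEmdist. Qed.

Lemma ball_open_metric x r : open (ball x r).
Proof.
rewrite openE => y; rewrite in_ball => xy.
rewrite /interior -nbhs_ballE; exists (r - mdist x y) => /=.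
  by rewrite subr_gt0.
move=> z; rewrite !in_ball => yz.
by rewrite (le_lt_trans (metric_triangle x y z))// -ltrBrDl.
Qed.

Lemma open_borel (A : set M) : open A -> measurable (A : set (borel M)).
Proof. exact: sub_sigma_algebra. Qed.

Lemma ball_borel x r : measurable (ball x r : set (borel M)).
Proof. by apply: open_borel; exact: ball_open_metric. Qed.

Lemma mdist_borel x : measurable_fun [set: borel M] (mdist x : borel M -> R).
Proof.
apply: (measurability _ (RGenInftyO.measurableE R)).
move=> /= _ [_ [a ->]] <-; apply: measurableI => //.
have -> : (mdist x) @^-1` `]-oo, a[ = ball x a.
  by apply/seteqP; split=> y /=; rewrite in_ball in_itv/=.
exact: ball_borel.
Qed.

Lemma lower_semicontinuous_borel (f : M -> \bar R) : lower_semicontinuous f ->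
  measurable_fun [set: borel M] (f : borel M -> \bar R).
Proof.
move=> scif; apply: (measurability _ (ErealGenOInfty.measurableE R)).
move=> /= _ [_ [a ->]] <-; apply: measurableI => //; apply: open_borel.
by rewrite preimage_itvoy; move/lower_semicontinuousP : scif; exact.
Qed.

Lemma bigcup_ball x : \bigcup_n ball x n%:R = [set: M].
Proof.
apply/seteqP; split=> // y _; exists (Num.truncn (mdist x y)).+1 => //.
by rewrite in_ball truncnS_gt.
Qed.

End metric_borel.

(** * Real-valued volumes, densities and tails *)

Section radial_functions.
Context {R : realType} {M : completeMetricType R}.
Variable mu : {measure set (borel M) -> \bar R}.

Definition ball_volume (x : M) (r : R) : R := fine (mu (ball x r)).

Definition radial_density (x : M) (t : R) : R := t / ball_volume x t.

Definition real_tail (x : M) (r : R) : R := fine (tail mu x r).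

(** The properties of [mu] on which both implications rest. Finiteness of the tail is asked at one
    radius per centre; [tail_lty] extends it to all positive radii. *)
Definition regular_volume (D : R) : Prop :=
  [/\ 0 < D,
      forall x r, 0 < r -> (0 < mu (ball x r) < +oo)%E,
      forall x r, 0 < r -> (mu (ball x (2 * r)%R) <= D%:E * mu (ball x r))%E
    & forall x, exists2 r, 0 < r & (tail mu x r < +oo)%E].

End radial_functions.

(** * Doubling estimates for tails *)

Section tails.
Context {R : realType} {M : completeMetricType R}.
Variables (mu : {measure set (borel M) -> \bar R}) (D : R).
Hypothesis mu_regular : regular_volume mu D.
Local Notation vol := (ball_volume mu).
Local Notation rho := (radial_density mu).
Local Notation rtail := (real_tail mu).

Lemma vol_gt0 x r : 0 < r -> 0 < vol x r.
Proof. by move=> r0; apply: fine_gt0; case: mu_regular => _ + _ _; apply. Qed.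

Lemma ball_le0 (x : M) r : r <= 0 -> ball x r = set0.
Proof.
move=> r0; apply/seteqP; split=> // y; rewrite in_ball /= ltNge.
by rewrite (le_trans r0)// mdist_ge0.
Qed.

Lemma vol_le0 x r : r <= 0 -> vol x r = 0.
Proof. by move=> r0; rewrite /ball_volume ball_le0// measure0. Qed.

Lemma mu_ballE x r : mu (ball x r) = (vol x r)%:E.
Proof.
have [r0|r0] := leP r 0; first by rewrite vol_le0// ball_le0// measure0.
case: mu_regular => _ /(_ x r r0) /andP[h1 h2] _ _.
by rewrite fineK// ge0_fin_numE// ltW.
Qed.

Lemma vol_nondecreasing x : {homo vol x : r s / r <= s}.
Proof.
move=> r s rs; rewrite -lee_fin -!mu_ballE le_measure// ?inE.
- exact: ball_borel.
- exact: ball_borel.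
- exact: le_ball.
Qed.

Lemma vol_double x r : 0 < r -> vol x (2 * r) <= D * vol x r.
Proof.
move=> r0; rewrite -lee_fin EFinM -!mu_ballE.
by case: mu_regular => _ _ + _; apply.
Qed.

Lemma doubling_gt0 : 0 < D. Proof. by case: mu_regular. Qed.

Lemma radial_density_measurable x : measurable_fun setT (rho x).
Proof.
have -> : rho x = fun t => t * vol x t `^ (- 1).
  by apply/funext => t; rewrite powR_inv1// fine_ge0.
apply: measurable_funM => //.
apply: (measurableT_comp (measurable_powR (- 1))).
by apply: nondecreasing_measurable => //; exact: vol_nondecreasing.
Qed.

Lemma radial_density_ge0 x t : 0 <= t -> 0 <= rho x t.
Proof. by move=> t0; rewrite divr_ge0// fine_ge0. Qed.

Lemma radial_densityE x t : 0 < t ->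
  (t%:E / mu (ball x t) = (rho x t)%:E)%E.
Proof. by move=> t0; rewrite mu_ballE inver gt_eqF ?vol_gt0. Qed.

Lemma tailE x r : 0 <= r ->
  tail mu x r = (\int[lebesgue_measure]_(t in `]r, +oo[) (rho x t)%:E)%E.
Proof.
move=> r0; apply: eq_integral => t; rewrite inE/= in_itv/= andbT => rt.
by rewrite radial_densityE// (le_lt_trans r0).
Qed.

Lemma tail_nonincreasing x a b : 0 <= a -> a <= b -> (tail mu x b <= tail mu x a)%E.
Proof.
move=> a0 ab; rewrite !tailE ?(le_trans a0)//; apply: ge0_subset_integral => //.
- by apply/measurable_EFinP; apply: measurable_funS (radial_density_measurable x).
- move=> t /=; rewrite in_itv/= andbT => at_.
  by rewrite lee_fin radial_density_ge0// ltW// (le_lt_trans a0).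
- by move=> t /=; rewrite !in_itv/= !andbT; exact: le_lt_trans.
Qed.

Lemma tail_ge0 x r : 0 <= r -> (0 <= tail mu x r)%E.
Proof.
move=> r0; rewrite tailE//; apply: integral_ge0 => t.
rewrite /= in_itv/= andbT lee_fin => rt.
by rewrite radial_density_ge0// ltW// (le_lt_trans r0).
Qed.

(** Below the radius [d] of finiteness only the bounded interval []r, d]] is added, and there the
    density is at most [d / vol x r]. *)
Lemma tail_lty x r : 0 < r -> (tail mu x r < +oo)%E.
Proof.
move=> r0; have [d d0 dfin] : exists2 d, 0 < d & (tail mu x d < +oo)%E.
  by case: mu_regular.
have [dr|/ltW rd] := leP d r.
  by apply: le_lt_trans dfin; apply: tail_nonincreasing => //; exact: ltW.
rewrite tailE ?(ltW r0)// (ge0_integral_itv_split (e := +oo%O) rd)//; last 2 first.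
- by apply/measurable_EFinP; apply: measurable_funS (radial_density_measurable x).
- by move=> t rt; rewrite lee_fin radial_density_ge0// ltW// (lt_trans r0).
rewrite -tailE ?(ltW d0)//; apply: lte_add_pinfty => //.
apply: (@le_lt_trans _ _ (\int[lebesgue_measure]_(t in `]r, d]) (d / vol x r)%:E)%E).
  apply: ge0_le_integral_any => t /=; rewrite in_itv/= => /andP[rt td];
    have t0 := lt_trans r0 rt.
    by rewrite lee_fin radial_density_ge0// ltW.
  rewrite lee_fin; apply: ler_pM => //; rewrite ?invr_ge0 ?fine_ge0 ?(ltW t0)//.
  by rewrite lef_pV2 ?posrE ?vol_gt0//; apply: vol_nondecreasing; exact: ltW.
rewrite integral_cst//= lebesgue_measure_itv/= lte_fin.
by case: ifP => _; rewrite ?mule0// -EFinB -EFinM ltry.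
Qed.

Lemma rtailE x r : 0 < r -> tail mu x r = (rtail x r)%:E.
Proof.
by move=> r0; rewrite fineK// ge0_fin_numE ?tail_lty// tail_ge0// ltW.
Qed.

Lemma tail_mdist_measurable x :
  measurable_fun [set: borel M] (fun y => tail mu x (mdist x y) : \bar R).
Proof.
(* [tail] is known to decrease on non-negative radii only; truncating at 0 and negating gives a
   nondecreasing function on the whole line. *)
have -> : (fun y => tail mu x (mdist x y)) =
    -%E \o ((fun t : R => - tail mu x (Num.max 0%R t))%E \o mdist x).
  by apply/funext => y /=; rewrite oppeK max_r// mdist_ge0.
apply: measurableT_comp => //; apply: measurableT_comp; last exact: mdist_borel.
apply: nondecreasing_emeasurable => s t st; rewrite leeN2.
apply: tail_nonincreasing; first by rewrite le_max lexx.
by rewrite ge_max !le_max lexx st orbT.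
Qed.

Lemma integral_densityE x a b : 0 < a -> a <= b ->
  (\int[lebesgue_measure]_(t in `]a, b]) (rho x t)%:E = (rtail x a - rtail x b)%:E)%E.
Proof.
move=> a0 ab; rewrite EFinB -!rtailE ?(lt_le_trans a0)//.
rewrite !tailE ?(ltW a0) ?(le_trans (ltW a0))//.
rewrite (ge0_integral_itv_split (e := +oo%O) ab)//.
- rewrite addeK//; rewrite -tailE ?(le_trans (ltW a0))// rtailE//.
  exact: lt_le_trans ab.
- apply/measurable_EFinP; apply: measurable_funS (radial_density_measurable x) => //.
- by move=> t at_; rewrite lee_fin radial_density_ge0// ltW// (lt_trans a0).
Qed.

Lemma rtail_nonincreasing x a b : 0 < a -> a <= b -> rtail x b <= rtail x a.
Proof.
move=> a0 ab; rewrite -subr_ge0 -lee_fin -integral_densityE//.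
apply: integral_ge0 => t /=; rewrite in_itv/= => /andP[at_ _].
by rewrite lee_fin radial_density_ge0// ltW// (lt_trans a0).
Qed.

Lemma integral_density_le x (a b : R) (f : R -> \bar R) (c : R) : 0 < a -> a <= b -> 0 <= c ->
  measurable_fun `]a, b] f ->
  (forall t, t \in `]a, b] -> 0 <= f t <= c%:E)%E ->
  (\int[lebesgue_measure]_(t in `]a, b]) (f t * (rho x t)%:E) <=
     (c * (rtail x a - rtail x b))%:E)%E.
Proof.
move=> a0 ab c0 mf fc; rewrite EFinM -integral_densityE//.
have mrho : measurable_fun `]a, b] (EFin \o rho x).
  by apply/measurable_EFinP; apply: measurable_funS (radial_density_measurable x).
have rho0 t : t \in `]a, b] -> (0 <= (rho x t)%:E)%E.
  rewrite in_itv/= => /andP[h _].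
  by rewrite lee_fin radial_density_ge0// (ltW (lt_trans a0 h)).
rewrite -ge0_integralZl_EFin//; apply: ge0_le_integral_any => t /= tab.
  by rewrite mule_ge0 ?rho0//; case/andP: (fc _ tab).
by rewrite lee_wpmul2r ?rho0//; case/andP: (fc _ tab).
Qed.

Lemma integral_density_ge x (a b : R) (f : R -> \bar R) (c : R) : 0 < a -> a <= b -> 0 <= c ->
  (forall t, t \in `]a, b] -> c%:E <= f t)%E ->
  ((c * (rtail x a - rtail x b))%:E <=
  \int[lebesgue_measure]_(t in `]a, b]) (f t * (rho x t)%:E))%E.
Proof.
move=> a0 ab c0 fc; rewrite EFinM -integral_densityE//.
have mrho : measurable_fun `]a, b] (EFin \o rho x).
  by apply/measurable_EFinP; apply: measurable_funS (radial_density_measurable x).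
have rho0 t : t \in `]a, b] -> (0 <= (rho x t)%:E)%E.
  rewrite in_itv/= => /andP[h _].
  by rewrite lee_fin radial_density_ge0// (ltW (lt_trans a0 h)).
rewrite -ge0_integralZl_EFin//; apply: ge0_le_integral_any => t /= tab.
  by rewrite mule_ge0 ?rho0// lee_fin.
by rewrite lee_wpmul2r ?rho0// fc.
Qed.

(** On []a, 2a]], of length a, the radius is at most 2a and the volume at least [vol x a]. The next
    lemma uses the opposite bounds. *)
Lemma rtail_decrement_le x a : 0 < a ->
  rtail x a - rtail x (2 * a) <= 2 * a ^+ 2 / vol x a.
Proof.
move=> a0; have a2 : a <= 2 * a by rewrite ler_peMl ?(ltW a0)// ler1n.
rewrite -lee_fin -integral_densityE//.
have -> : 2 * a ^+ 2 / vol x a = (2 * a / vol x a) * a by rewrite expr2; ring.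
apply: (@le_trans _ _ (\int[lebesgue_measure]_(t in `]a, (2 * a)%R]) (2 * a / vol x a)%:E)%E).
  apply: ge0_le_integral_any => t /=; rewrite in_itv/= => /andP[t1 t2].
    by rewrite lee_fin radial_density_ge0// (ltW (lt_trans a0 t1)).
  have t0 := lt_trans a0 t1.
  rewrite lee_fin; apply: ler_pM => //; rewrite ?invr_ge0 ?fine_ge0 ?(ltW t0)//.
  by rewrite lef_pV2 ?posrE ?vol_gt0//; apply: vol_nondecreasing; exact: ltW.
rewrite integral_cst//= lebesgue_measure_itv/= lte_fin ltr_pMl// ltr1n.
rewrite -EFinB -EFinM lee_fin mulrC [leRHS]mulrC ler_wpM2r ?divr_ge0 ?mulr_ge0 ?fine_ge0 ?(ltW a0)//.
by rewrite lerBlDr -mulr2n mulr_natl.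
Qed.

Lemma rtail_decrement_ge x a : 0 < a ->
  a ^+ 2 / vol x (2 * a) <= rtail x a - rtail x (2 * a).
Proof.
move=> a0; have a2 : a <= 2 * a by rewrite ler_peMl ?(ltW a0)// ler1n.
have a20 : 0 < 2 * a by exact: lt_le_trans a2.
rewrite -lee_fin -integral_densityE//.
have -> : a ^+ 2 / vol x (2 * a) = (a / vol x (2 * a)) * a by rewrite expr2; ring.
apply: (@le_trans _ _ (\int[lebesgue_measure]_(t in `]a, (2 * a)%R]) (a / vol x (2 * a))%:E)%E); last first.
  apply: ge0_le_integral_any => t /=; rewrite in_itv/= => /andP[t1 t2].
    by rewrite lee_fin divr_ge0 ?fine_ge0 ?(ltW a0).
  have t0 := lt_trans a0 t1.
  rewrite lee_fin; apply: ler_pM; rewrite ?invr_ge0 ?fine_ge0 ?(ltW a0) ?(ltW t1)//.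
  by rewrite lef_pV2 ?posrE ?vol_gt0//; exact: vol_nondecreasing.
rewrite integral_cst//= lebesgue_measure_itv/= lte_fin ltr_pMl// ltr1n.
rewrite -EFinB -EFinM lee_fin ler_wpM2l ?divr_ge0 ?mulr_ge0 ?fine_ge0 ?(ltW a0)//.
by rewrite lerBrDr -mulr2n mulr_natl.
Qed.

Lemma rtail_ge0 x a : 0 < a -> 0 <= rtail x a.
Proof.
move=> a0; rewrite -lee_fin -rtailE// tailE ?(ltW a0)//; apply: integral_ge0 => t.
by rewrite /= in_itv/= andbT lee_fin => rt; rewrite radial_density_ge0 ?(ltW (lt_trans a0 rt)).
Qed.

Lemma rtail_gt0 x a : 0 < a -> 0 < rtail x a.
Proof.
move=> a0; have a20 : 0 < 2 * a by rewrite mulr_gt0.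
apply: (@lt_le_trans _ _ (rtail x a - rtail x (2 * a))).
  by apply: lt_le_trans (rtail_decrement_ge _ _) => //; rewrite divr_gt0 ?vol_gt0 ?exprn_gt0.
by rewrite gerBl rtail_ge0.
Qed.

(** Consecutive dyadic shells carry comparable m_x-mass: the two bounds above, taken at a and 2a,
    differ by the volume ratio of the radii a and 4a, which two doublings control. *)
Lemma rtail_decrement_double x a : 0 < a ->
  rtail x a - rtail x (2 * a) <=
  D ^+ 2 * (rtail x (2 * a) - rtail x (2 * (2 * a))).
Proof.
move=> a0; have a20 : 0 < 2 * a by rewrite mulr_gt0.
apply: le_trans (rtail_decrement_le _ a0) _.
apply: le_trans (ler_wpM2l (sqr_ge0 D) (rtail_decrement_ge x a20)).
have v4 : vol x (2 * (2 * a)) <= D ^+ 2 * vol x a.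
  rewrite expr2 -mulrA (le_trans (vol_double _ a20))//.
  by rewrite ler_wpM2l ?(ltW doubling_gt0)// vol_double.
set w := vol x (2 * (2 * a)) in v4 *.
rewrite ler_pdivrMr ?vol_gt0//.
have -> : D ^+ 2 * ((2 * a) ^+ 2 / w) * vol x a = D ^+ 2 * (2 * a) ^+ 2 * vol x a / w.
  by ring.
rewrite ler_pdivlMr ?vol_gt0 ?mulr_gt0//.
apply: (@le_trans _ _ (2 * a ^+ 2 * (D ^+ 2 * vol x a))).
  by apply: ler_wpM2l => //; rewrite mulr_ge0 ?sqr_ge0.
have : 0 <= a ^+ 2 * (D ^+ 2 * vol x a).
  by rewrite mulr_ge0 ?sqr_ge0// mulr_ge0 ?sqr_ge0 ?fine_ge0.
by nra.
Qed.

Let A : R := D ^+ 2 + 1.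

(** With T for the tail, here and below: T(a) - T(2a) <= D^2 (T(2a) - T(4a)) <= D^2 T(2a). The 1 in
    [A] accounts for moving T(2a) to the right. *)
Lemma rtail_double x a : 0 < a -> rtail x a <= A * rtail x (2 * a).
Proof.
move=> a0; have := rtail_decrement_double x a0.
have : 0 <= rtail x (2 * (2 * a)) by rewrite rtail_ge0 ?mulr_gt0.
have := sqr_ge0 D; rewrite /A; nra.
Qed.

Lemma rtail_expn x a k : 0 < a -> rtail x a <= A ^+ k * rtail x (2 ^+ k * a).
Proof.
move=> a0; elim: k => [|k IH]; first by rewrite !expr0 !mul1r.
apply: (le_trans IH); rewrite exprSr -mulrA ler_wpM2l ?exprn_ge0 ?addr_ge0 ?sqr_ge0//.
by rewrite (le_trans (rtail_double _ _)) ?mulr_gt0 ?exprn_gt0// mulrA -exprS.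
Qed.

(** For t > r the ball B(y, t) lies in B(x, 2t), so one doubling compares the two densities
    pointwise. *)
Lemma rtail_center x y r : 0 < r -> mdist x y <= r -> rtail x r <= D * rtail y r.
Proof.
move=> r0 xy; rewrite -lee_fin EFinM -!rtailE// !tailE ?(ltW r0)//.
rewrite -ge0_integralZl_EFin ?(ltW doubling_gt0)//; last 2 first.
- move=> t /=; rewrite in_itv/= andbT lee_fin => rt.
  by rewrite radial_density_ge0 ?(ltW (lt_trans r0 rt)).
- by apply/measurable_EFinP; apply: measurable_funS (radial_density_measurable y).
apply: ge0_le_integral_any => t /=; rewrite in_itv/= andbT => rt;
  have t0 := lt_trans r0 rt.
  by rewrite lee_fin radial_density_ge0 ?(ltW t0).
rewrite -EFinM lee_fin mulrCA ler_pM2l// ler_pdivlMr ?vol_gt0// mulrC.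
rewrite ler_pdivrMr ?vol_gt0//; apply: le_trans (vol_double _ t0).
rewrite -lee_fin -!mu_ballE le_measure// ?inE; [exact: ball_borel..|].
move=> z; rewrite !in_ball => yz.
rewrite (le_lt_trans (metric_triangle x y z))// mulr_natl mulr2n ltr_leD ?(ltW yz)//.
by rewrite (le_lt_trans xy).
Qed.

(** Otherwise every []s, 2^k s]] has m_x-mass at most T(s) / 2, and by monotone convergence so has
    []s, +oo[], whose mass is T(s) > 0. *)
Lemma rtail_halving x s : 0 < s -> exists k, rtail x (2 ^+ k * s) <= rtail x s / 2.
Proof.
move=> s0; apply/not_existsP => h.
have {}h k : rtail x s / 2 <= rtail x (2 ^+ k * s).
  by have /negP := h k; rewrite -ltNge => /ltW.
have k1 k : 1 <= (2 ^+ k : R) by rewrite exprn_ege1// ler1n.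
have ts := rtail_gt0 x s0.
suff : ((rtail x s)%:E <= (rtail x s / 2)%:E)%E by rewrite lee_fin; lra.
rewrite -[leLHS]rtailE// tailE ?(ltW s0)//.
have -> : `]s, +oo[%classic = \bigcup_k `]s, 2 ^+ k * s]%classic.
  apply/seteqP; split => t /=; last first.
    by move=> [k _] /=; rewrite !in_itv/= andbT => /andP[].
  (* With n the integer part of t / s plus one, t / s < n <= 2^n; the later dyadic exhaustions
     choose their index in the same way. *)
  rewrite in_itv/= andbT => st; exists (Num.truncn (t / s)).+1 => //=.
  rewrite in_itv/= st/= -ler_pdivrMr//.
  apply: (@le_trans _ _ (Num.truncn (t / s)).+1%:R); first exact/ltW/truncnS_gt.
  by rewrite -natrX ler_nat ltnW// ltn_expl.
apply: ge0_integral_bigcup_le.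
- move=> m n mn; rewrite subsetEset => t /=; rewrite !in_itv/= => /andP[-> /=] h1.
  by rewrite (le_trans h1)// ler_wpM2r ?(ltW s0)// ler_weXn2l// ler1n.
- by [].
- move=> n; apply/measurable_EFinP; apply: measurable_funS (radial_density_measurable x) => //.
- move=> n t /=; rewrite in_itv/= => /andP[st _].
  by rewrite lee_fin radial_density_ge0 ?(ltW (lt_trans s0 st)).
- move=> n; rewrite integral_densityE ?ler_peMl ?(ltW s0)//.
  by rewrite lee_fin; have := h n; lra.
Qed.

End tails.

(** * Necessity: a solution forces (i) and (ii) *)

Section necessity.
Context {R : realType} {M : completeMetricType R}.
Variables (mu : {measure set (borel M) -> \bar R}) (D : R).
Hypothesis mu_regular : regular_volume mu D.
Variables (sigma : {measure set (borel M) -> \bar R}) (q : R).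
Hypothesis q_gt1 : 1 < q.
Variables (u : M -> R) (c : R).
Hypotheses (c_gt0 : 0 < c) (u_gt0 : forall x, 0 < u x)
  (u_measurable : measurable_fun [set: borel M] (u : borel M -> R)).
Hypothesis u_super : forall x,
  (c%:E * \int[sigma]_(y in [set: borel M])
            (tail mu x (mdist x y) * (u y `^ q)%:E) <= (u x)%:E)%E.

Local Notation rho := (radial_density mu).
Local Notation rtail := (real_tail mu).
Let A : R := D ^+ 2 + 1.
Let p : R := q - 1.
Let k0 : R := c / (D * A).

Let q_gt0 : 0 < q. Proof. exact: lt_trans q_gt1. Qed.
Let p_gt0 : 0 < p. Proof. by rewrite subr_gt0. Qed.
Let A_gt0 : 0 < A. Proof. by rewrite ltr_wpDl ?sqr_ge0. Qed.
Let D_gt0 : 0 < D. Proof. by case: mu_regular. Qed.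
Let k0_gt0 : 0 < k0. Proof. by rewrite divr_gt0// mulr_gt0. Qed.

Let uq_measurable (B : set (borel M)) : measurable_fun B (fun y => u y `^ q).
Proof.
apply: (@measurable_funTS _ _ _ _ B).
exact: (measurableT_comp (measurable_powR q) u_measurable).
Qed.

Let Eu_measurable (B : set (borel M)) :
  measurable_fun B (fun y => (u y `^ q)%:E : \bar R).
Proof. by apply/measurable_EFinP. Qed.

Definition energy (x : M) (r : R) : \bar R :=
  (\int[sigma]_(y in (ball x r : set (borel M))) (u y `^ q)%:E)%E.

Let rN x r : R := fine (energy x r).

Lemma rtail_le_tail x a b : 0 <= a -> a <= b -> 0 < b ->
  ((rtail x b)%:E <= tail mu x a)%E.
Proof.
by move=> a0 ab b0; rewrite -(rtailE mu_regular)// (tail_nonincreasing mu_regular).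
Qed.

(** With m the maximum, d(y, z) <= d(y, x) + d(x, z) <= 2m, so the kernel at y is at least the tail
    at y of 2m. One doubling ([A]) and one change of centre ([D]) compare this with the tail at x of
    m. *)
Lemma rtail_le_kernel x y z s : 0 < s -> mdist x y < s ->
  ((rtail x (Num.max s (mdist x z)))%:E <=
     (D * A)%:E * tail mu y (mdist y z))%E.
Proof.
move=> s0 xy; set m := Num.max _ _.
have sm : s <= m by rewrite le_max lexx.
have m0 : 0 < m by exact: lt_le_trans sm.
have m20 : 0 < 2 * m by rewrite mulr_gt0.
apply: (@le_trans _ _ ((D * A) * rtail y (2 * m))%:E); last first.
  rewrite EFinM lee_wpmul2l ?lee_fin ?mulr_ge0 ?(ltW D_gt0) ?(ltW A_gt0)//.
  apply: rtail_le_tail => //; first exact: mdist_ge0.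
  rewrite (le_trans (metric_triangle y x z))// metric_sym mulr_natl mulr2n lerD//.
    exact: le_trans (ltW xy) sm.
  by rewrite le_max lexx orbT.
rewrite lee_fin (le_trans (rtail_double mu_regular _ m0))// -/A [leRHS]mulrAC.
rewrite mulrC ler_wpM2r ?(ltW A_gt0)//; apply: rtail_center => //.
by rewrite (le_trans (ltW xy))// (le_trans sm)// ler_peMl ?(ltW m0)// ler1n.
Qed.

Lemma super_step y (phi : M -> R) :
  measurable_fun [set: borel M] (phi : borel M -> R) -> (forall z, 0 <= phi z) ->
  (forall z, (phi z)%:E <= (D * A)%:E * tail mu y (mdist y z))%E ->
  (k0%:E * \int[sigma]_(z in [set: borel M]) ((phi z)%:E * (u z `^ q)%:E) <= (u y)%:E)%E.
Proof.
move=> mphi phi0 phile; apply: le_trans (u_super y).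
have DA0 : 0 < D * A by rewrite mulr_gt0.
rewrite /k0 EFinM -muleA lee_wpmul2l ?lee_fin ?(ltW c_gt0)//.
rewrite -ge0_integralZl_EFin//; last 3 first.
- by move=> z _; rewrite mule_ge0 ?lee_fin ?powR_ge0.
- by apply: emeasurable_funM => //; exact/measurable_EFinP.
- by rewrite invr_ge0 ltW.
apply: ge0_le_integral_any => z _.
  by rewrite mule_ge0 ?mule_ge0 ?lee_fin ?invr_ge0 ?powR_ge0 ?(ltW DA0).
rewrite muleA lee_wpmul2r ?lee_fin ?powR_ge0//.
by rewrite lee_pdivrMl.
Qed.

Lemma energy_ge0 x r : (0 <= energy x r)%E.
Proof. by apply: integral_ge0 => y _; rewrite lee_fin powR_ge0. Qed.

Lemma indic_energy x r : (\int[sigma]_(z in [set: borel M])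
  ((\1_(ball x r : set (borel M)) z)%:E * (u z `^ q)%:E) = energy x r)%E.
Proof.
rewrite /energy [RHS]integral_mkcond; apply: eq_integral => z _.
by rewrite patchE indicE; case: ifPn => _; rewrite ?mul1e ?mul0e.
Qed.

Lemma indic_measurable x r :
  measurable_fun [set: borel M] (\1_(ball x r : set (borel M)) : borel M -> R).
Proof. by apply: measurable_indic; exact: ball_borel. Qed.

Lemma in_ball_mem x r z : (z \in (ball x r : set M)) = (mdist x z < r).
Proof. by apply/idP/idP; rewrite inE in_ball. Qed.

(** Tested with [rtail x r] times the indicator of the ball, the inequality bounds a positive
    multiple of the energy by the finite number [u x]. *)
Lemma energy_lty x r : 0 < r -> (energy x r < +oo)%E.
Proof.
move=> r0; have t0 := rtail_gt0 mu_regular x r0.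
have : (k0%:E * \int[sigma]_(z in [set: borel M])
    ((rtail x r * \1_(ball x r : set (borel M)) z)%:E * (u z `^ q)%:E) <= (u x)%:E)%E.
  apply: super_step => [||z].
  - by apply: measurable_funM => //; exact: indic_measurable.
  - by move=> z; rewrite mulr_ge0 ?(ltW t0).
  - rewrite indicE in_ball_mem; case: ltP => xz.
      have xx : mdist x x < r by rewrite mdistxx.
      rewrite mulr1; apply: le_trans (rtail_le_kernel z r0 xx).
      by rewrite max_l// ltW.
    rewrite mulr0 mule_ge0 ?lee_fin ?mulr_ge0 ?(ltW D_gt0) ?(ltW A_gt0)//.
    have xz0 := lt_le_trans r0 xz.
    apply: le_trans (rtail_le_tail x (mdist_ge0 x z) (lexx _) xz0).
    by rewrite lee_fin (rtail_ge0 mu_regular).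
under eq_integral do rewrite EFinM -muleA.
rewrite ge0_integralZl_EFin ?(ltW t0)//; last 2 first.
- by move=> z _; rewrite mule_ge0 ?lee_fin ?powR_ge0.
- by apply: emeasurable_funM => //; apply/measurable_EFinP; exact: indic_measurable.
rewrite indic_energy muleA -EFinM => h.
rewrite ltNge leye_eq; apply/negP => /eqP e; move: h.
by rewrite e gt0_muley// lte_fin (mulr_gt0 k0_gt0).
Qed.

Lemma energyE x r : 0 < r -> energy x r = (rN x r)%:E.
Proof. by move=> r0; rewrite fineK// ge0_fin_numE ?energy_ge0// energy_lty. Qed.

Lemma rN_ge0 x r : 0 <= rN x r. Proof. by rewrite fine_ge0// energy_ge0. Qed.

(* The sum telescopes: it is the value of the tail at the least radius 2^k s,
   k <= m, exceeding d(x, z), and 0 if there is none. *)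
Fixpoint dyadic_kernel (m : nat) (x : M) (s : R) (z : M) : R :=
  if m is m'.+1 then
    (rtail x s - rtail x (2 * s)) * \1_(ball x s : set (borel M)) z +
    dyadic_kernel m' x (2 * s) z
  else rtail x s * \1_(ball x s : set (borel M)) z.

(** F_0 of the overview for the radii 2^j s; F_k is the value at [m - k] and 2^k s. It is the
    integral of [dyadic_kernel] against u^q sigma. *)
Fixpoint dyadic_potential (m : nat) (x : M) (s : R) : R :=
  if m is m'.+1 then
    (rtail x s - rtail x (2 * s)) * rN x s + dyadic_potential m' x (2 * s)
  else rtail x s * rN x s.

Let rtail_dec x s : 0 < s -> 0 <= rtail x s - rtail x (2 * s).
Proof.
move=> s0; rewrite subr_ge0; apply: (rtail_nonincreasing mu_regular) => //.
by rewrite ler_peMl ?(ltW s0)// ler1n.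
Qed.

Lemma dyadic_kernel_ge0 m x s z : 0 < s -> 0 <= dyadic_kernel m x s z.
Proof.
elim: m s => [|m IH] s s0 /=; first by rewrite mulr_ge0 ?(rtail_ge0 mu_regular).
by rewrite addr_ge0 ?IH ?mulr_gt0// mulr_ge0 ?rtail_dec.
Qed.

Lemma dyadic_kernel_measurable m x s :
  measurable_fun [set: borel M] (dyadic_kernel m x s : borel M -> R).
Proof.
elim: m s => [|m IH] s /=.
  by apply: measurable_funM => //; exact: indic_measurable.
apply: measurable_funD => //; apply: measurable_funM => //; exact: indic_measurable.
Qed.

(** Induction with s doubled at each step: inside B(x, s) the increment completes T(2s) to T(s), and
    outside it vanishes. *)
Lemma dyadic_kernel_le m x s z : 0 < s ->
  dyadic_kernel m x s z <= rtail x (Num.max s (mdist x z)).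
Proof.
elim: m s => [|m IH] s s0 /=; rewrite indicE in_ball_mem.
  case: ltP => xz; first by rewrite mulr1.
  by rewrite mulr0 (rtail_ge0 mu_regular)// (lt_le_trans s0).
have s20 : 0 < 2 * s by rewrite mulr_gt0.
have s2 : s <= 2 * s by rewrite ler_peMl ?(ltW s0)// ler1n.
case: ltP => xz.
  rewrite mulr1 -lerBrDl opprB addrCA subrr addr0 (le_trans (IH _ s20))//.
  by rewrite (rtail_nonincreasing mu_regular)// le_max lexx.
rewrite mulr0 add0r (le_trans (IH _ s20))//.
rewrite (rtail_nonincreasing mu_regular) ?(lt_le_trans s0)//.
by rewrite le_max lexx orbT.
Qed.

Lemma dyadic_kernel_integral m x s : 0 < s ->
  (\int[sigma]_(z in [set: borel M])
    ((dyadic_kernel m x s z)%:E * (u z `^ q)%:E) = (dyadic_potential m x s)%:E)%E.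
Proof.
have key (a : R) r : 0 <= a -> 0 < r -> (\int[sigma]_(z in [set: borel M])
    ((a * \1_(ball x r : set (borel M)) z)%:E * (u z `^ q)%:E) = (a * rN x r)%:E)%E.
  move=> a0 r0; under eq_integral do rewrite EFinM -muleA.
  rewrite ge0_integralZl_EFin//; last 2 first.
  - by move=> z _; rewrite mule_ge0 ?lee_fin ?powR_ge0.
  - by apply: emeasurable_funM => //; apply/measurable_EFinP; exact: indic_measurable.
  by rewrite indic_energy energyE// -EFinM.
elim: m s => [|m IH] s s0 /=; first by rewrite key// (rtail_ge0 mu_regular).
have s20 : 0 < 2 * s by rewrite mulr_gt0.
rewrite EFinD -IH// -key ?rtail_dec// -ge0_integralD//.
- by apply: eq_integral => z _; rewrite -muleDl// EFinD.
- by move=> z _; rewrite mule_ge0 ?lee_fin ?powR_ge0// mulr_ge0 ?rtail_dec.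
- apply: emeasurable_funM => //; apply/measurable_EFinP.
  by apply: measurable_funM => //; exact: indic_measurable.
- by move=> z _; rewrite mule_ge0 ?lee_fin ?powR_ge0 ?dyadic_kernel_ge0.
- apply: emeasurable_funM => //; apply/measurable_EFinP.
  exact: dyadic_kernel_measurable.
Qed.

Lemma dyadic_potential_le m x s y : 0 < s -> mdist x y < s ->
  k0 * dyadic_potential m x s <= u y.
Proof.
move=> s0 xy; rewrite -lee_fin EFinM -dyadic_kernel_integral//.
apply: super_step => [||z]; first exact: dyadic_kernel_measurable.
  by move=> z; exact: dyadic_kernel_ge0.
apply: le_trans (rtail_le_kernel z s0 xy).
by rewrite lee_fin dyadic_kernel_le.
Qed.

Lemma dyadic_potential_ge0 m x s : 0 < s -> 0 <= dyadic_potential m x s.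
Proof.
elim: m s => [|m IH] s s0 /=; first by rewrite mulr_ge0 ?rN_ge0 ?(rtail_ge0 mu_regular).
by rewrite addr_ge0 ?IH ?mulr_gt0// mulr_ge0 ?rN_ge0 ?rtail_dec.
Qed.

Lemma dyadic_potential_ge m x s : 0 < s ->
  rtail x (2 ^+ m * s) * rN x (2 ^+ m * s) <= dyadic_potential m x s.
Proof.
elim: m s => [|m IH] s s0; first by rewrite expr0 mul1r.
rewrite exprSr -mulrA (le_trans (IH _ _)) ?mulr_gt0//=.
by rewrite lerDr mulr_ge0 ?rN_ge0 ?rtail_dec.
Qed.

Lemma sigma_set_le (B : set (borel M)) b : measurable B -> 0 <= b ->
  (forall y, B y -> b <= u y) ->
  ((b `^ q)%:E * sigma B <= \int[sigma]_(y in B) (u y `^ q)%:E)%E.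
Proof.
move=> mB b0 bu; rewrite -integral_cst//; apply: ge0_le_integral_any => y By.
  by rewrite lee_fin powR_ge0.
by rewrite lee_fin le_powR2r ?(ltW q_gt0)// bu.
Qed.

Lemma sigma_ball_le m x s : 0 < s ->
  (((k0 * dyadic_potential m x s) `^ q)%:E * sigma (ball x s) <= (rN x s)%:E)%E.
Proof.
move=> s0; rewrite -energyE//; apply: sigma_set_le; first exact: ball_borel.
  by rewrite mulr_ge0 ?(ltW k0_gt0) ?dyadic_potential_ge0.
by move=> y; rewrite in_ball; exact: dyadic_potential_le.
Qed.

(** As u > 0 everywhere, a vanishing integral of u^q over the ball leaves no mass there. *)
Lemma rN_eq0 x s : 0 < s -> rN x s = 0 -> sigma (ball x s) = 0%E.
Proof.
move=> s0 Ns; have := energyE x s0; rewrite Ns => e0.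
have mB := ball_borel x s.
have : (\int[sigma]_(y in (ball x s : set (borel M))) `|(u y `^ q)%:E| = 0)%E.
  rewrite -[RHS]e0; apply: eq_integral => y _.
  by rewrite gee0_abs// lee_fin powR_ge0.
move/(ae_eq_integral_abs sigma mB (@Eu_measurable _)) => [N [mN N0 sub]].
apply/eqP; rewrite -measure_le0 -N0 le_measure ?inE// => y xy.
apply: sub => /= /(_ xy) /eqP; rewrite eqe powR_eq0 gt_eqF ?u_gt0//.
Qed.

(** If the energy N is positive, the previous bound with m = 0 reads (k0 T N)^q sigma(B) <= N with a
    positive factor; if N = 0 the ball is null. *)
Lemma sigma_ball_lty x s : 0 < s -> (sigma (ball x s) < +oo)%E.
Proof.
move=> s0; have [/eqP N0|N0] := boolP (rN x s == 0); first by rewrite rN_eq0.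
have := sigma_ball_le 0 x s0; rewrite /= ltNge leye_eq => h.
apply/negP => /eqP e; move: h; rewrite e gt0_muley//.
rewrite lte_fin powR_gt0// (mulr_gt0 k0_gt0)// mulr_gt0 ?(rtail_gt0 mu_regular)//.
by rewrite lt_neqAle eq_sym N0 rN_ge0.
Qed.

Let S x r : R := fine (sigma (ball x r)).

Let sigmaE x r : 0 < r -> sigma (ball x r) = (S x r)%:E.
Proof. by move=> r0; rewrite fineK// ge0_fin_numE// sigma_ball_lty. Qed.

Let S_ge0 x r : 0 <= S x r. Proof. exact: fine_ge0. Qed.

Lemma sigma_ball_measurable x (B : set R) : measurable_fun B (fun t => sigma (ball x t)).
Proof.
apply: measurable_funTS; apply: nondecreasing_emeasurable => s t st.
by rewrite le_measure ?inE//; [exact: ball_borel..|exact: le_ball].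
Qed.

Lemma sigma_ball_le_in x (a b t : R) : 0 < b -> t \in `]a, b] ->
  (0 <= sigma (ball x t) <= (S x b)%:E)%E.
Proof.
rewrite in_itv/= => b0 /andP[_ tb]; rewrite measure_ge0/= -sigmaE//.
by rewrite le_measure ?inE//; [exact: ball_borel..|exact: le_ball].
Qed.

Let K : R := D ^+ 2 * k0 `^ (- q) / p.

(** With F and F' the potentials starting at 2a and 4a, F - F' = N(2a) (T(2a) - T(4a)). The shell
    []a, 2a]] is traded for the next one, at cost D^2, to make F - F' appear; [sigma_ball_le] brings
    k0^(-q) F^(-q) and convexity 1 / p. These are the factors of [K]. *)
Lemma dyadic_step m x a : 0 < a -> 0 < dyadic_potential m x (2 * (2 * a)) ->
  (\int[lebesgue_measure]_(t in `]a, (2 * a)%R])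
      (sigma (ball x t) * (rho x t)%:E) <=
   (K * (dyadic_potential m x (2 * (2 * a)) `^ (- p) -
         dyadic_potential m.+1 x (2 * a) `^ (- p)))%:E)%E.
Proof.
move=> a0 F0; have a2 : a <= 2 * a by rewrite ler_peMl ?(ltW a0)// ler1n.
have s0 : 0 < 2 * a by rewrite mulr_gt0.
apply: le_trans (integral_density_le mu_regular x (f := fun t => sigma (ball x t)) a0 a2 (S_ge0 x (2 * a)) _ _) _.
- exact: sigma_ball_measurable.
- by move=> t; exact: sigma_ball_le_in.
have := sigma_ball_le m.+1 x s0; rewrite sigmaE// -EFinM !lee_fin.
set F' := dyadic_potential m x _ in F0 *; set F := dyadic_potential m.+1 x _.
have FF' : F - F' = (rtail x (2 * a) - rtail x (2 * (2 * a))) * rN x (2 * a).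
  by rewrite /F /= addrK.
have F'F : F' <= F by rewrite -subr_ge0 FF' mulr_ge0 ?rtail_dec ?rN_ge0.
have Fp : 0 < F by exact: lt_le_trans F'F.
rewrite mulrC -ler_pdivlMr ?powR_gt0 ?(mulr_gt0 k0_gt0)// => SN.
have dec := rtail_decrement_double mu_regular x a0.
have Q0 : 0 <= S x (2 * a) by [].
apply: (@le_trans _ _ (S x (2 * a) * (D ^+ 2 * (rtail x (2 * a) - rtail x (2 * (2 * a)))))).
  exact: ler_wpM2l.
have := powR_lt0_decrement p_gt0 F0 F'F.
rewrite -/p (_ : p + 1 = q) ?subrK// => h.
apply: (@le_trans _ _ (D ^+ 2 * k0 `^ (- q) * ((F - F') * F `^ (- q)))); last first.
  have Dk : 0 <= D ^+ 2 * k0 `^ (- q) by rewrite mulr_ge0 ?sqr_ge0 ?powR_ge0.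
  by rewrite (le_trans (ler_wpM2l Dk h))// /K !mulrA lexx.
apply: (@le_trans _ _ (rN x (2 * a) / (k0 * F) `^ q * (D ^+ 2 * (rtail x (2 * a) - rtail x (2 * (2 * a)))))).
  by apply: ler_wpM2r => //; rewrite mulr_ge0 ?sqr_ge0 ?rtail_dec.
rewrite FF' powRM ?(ltW k0_gt0) ?(ltW Fp)// !powRN invfM le_eqVlt; apply/orP; left; apply/eqP.
by ring.
Qed.

(** Peeling off []a, 2a]] at each step, the potentials cancel in pairs; the one that remains at the
    outer end has no increments left and is just T N at the largest radius. *)
Lemma dyadic_sum m x a : 0 < a -> 0 < rN x (2 ^+ m * (2 * a)) ->
  (\int[lebesgue_measure]_(t in `]a, (2 ^+ m * a)%R])
      (sigma (ball x t) * (rho x t)%:E) <=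
   (K * ((rtail x (2 ^+ m * (2 * a)) * rN x (2 ^+ m * (2 * a))) `^ (- p) -
         dyadic_potential m x (2 * a) `^ (- p)))%:E)%E.
Proof.
elim: m a => [|m IH] a a0 N0.
  by rewrite !expr0 !mul1r /= set_itvoc0 integral_set0 subrr mulr0.
have a2 : a <= 2 * a by rewrite ler_peMl ?(ltW a0)// ler1n.
have s0 : 0 < 2 * a by rewrite mulr_gt0.
have e : 2 ^+ m.+1 * a = 2 ^+ m * (2 * a) by rewrite exprSr -mulrA.
have e' : 2 ^+ m.+1 * (2 * a) = 2 ^+ m * (2 * (2 * a)) by rewrite exprSr -mulrA.
have m1 : 2 * a <= 2 ^+ m * (2 * a) by rewrite ler_peMl ?(ltW s0)// exprn_ege1// ler1n.
have F0 : 0 < dyadic_potential m x (2 * (2 * a)).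
  apply: lt_le_trans (dyadic_potential_ge m x _); last by rewrite mulr_gt0.
  rewrite -e' mulr_gt0// (rtail_gt0 mu_regular)// mulr_gt0// exprn_gt0//.
rewrite e (ge0_integral_itv_split a2) ?bnd_simp//.
- rewrite e' in N0 *; have := IH _ s0 N0; have := dyadic_step a0 F0.
  move=> h1 h2; apply: le_trans (leeD h1 h2) _.
  by rewrite -EFinD lee_fin -mulrDr addrC addrA subrK.
- apply: emeasurable_funM; first exact: sigma_ball_measurable.
  by apply/measurable_EFinP; apply: measurable_funS (radial_density_measurable mu_regular x).
- move=> t at_; rewrite mule_ge0// lee_fin radial_density_ge0//.
  by rewrite ltW// (lt_trans a0).
Qed.

(** The bound over []r / 2^n, r]] is uniform in n: [dyadic_sum] always ends at radius 2r, and its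
    subtracted term is dropped. *)
Lemma wolff_potential_bound x r : 0 < r -> 0 < rN x (2 * r) ->
  (\int[lebesgue_measure]_(t in `]0%R, r])
      (sigma (ball x t) * (rho x t)%:E) <=
   (K * (rtail x (2 * r) * rN x (2 * r)) `^ (- p))%:E)%E.
Proof.
move=> r0 N0.
have r2 n : 0 < r / 2 ^+ n by rewrite divr_gt0// exprn_gt0.
have -> : `]0, r]%classic = \bigcup_n `]r / 2 ^+ n, r]%classic.
  apply/seteqP; split => t /=; last first.
    by move=> [n _] /=; rewrite !in_itv/= => /andP[/(lt_trans (r2 n)) -> ->].
  rewrite in_itv/= => /andP[t0 tr]; exists (Num.truncn (r / t)).+1 => //=.
  rewrite in_itv/= tr andbT ltr_pdivrMr ?exprn_gt0// mulrC -ltr_pdivrMr//.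
  apply: (@lt_le_trans _ _ (Num.truncn (r / t)).+1%:R); first exact/truncnS_gt.
  by rewrite -natrX ler_nat ltnW// ltn_expl.
apply: ge0_integral_bigcup_le.
- move=> m n mn; rewrite subsetEset => t /=; rewrite !in_itv/= => /andP[h1 ->].
  rewrite andbT (le_lt_trans _ h1)// ler_pM2l// lef_pV2 ?posrE ?exprn_gt0//.
  by rewrite ler_weXn2l// ler1n.
- by [].
- move=> n; apply: emeasurable_funM; first exact: sigma_ball_measurable.
  by apply/measurable_EFinP; apply: measurable_funS (radial_density_measurable mu_regular x).
- move=> n t /=; rewrite in_itv/= => /andP[st _].
  by rewrite mule_ge0// lee_fin radial_density_ge0 ?(ltW (lt_trans (r2 n) st)).
- move=> n; have e : 2 ^+ n * (r / 2 ^+ n) = r.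
    by rewrite mulrCA divff ?mulr1// gt_eqF// exprn_gt0.
  have e2 : 2 ^+ n * (2 * (r / 2 ^+ n)) = 2 * r by rewrite mulrCA e.
  have := @dyadic_sum n x _ (r2 n); rewrite e e2 => /(_ N0) h.
  apply: le_trans h _; rewrite lee_fin; apply: ler_wpM2l.
    by rewrite divr_ge0 ?(ltW p_gt0)// mulr_ge0 ?sqr_ge0 ?powR_ge0.
  by rewrite gerBl powR_ge0.
Qed.

(** A dyadic radius that swallows a ball charged by sigma. The telescoping bounds contain negative
    powers of the energy and start from such a radius. *)
Lemma exists_energy_gt0 o : (exists2 r, 0 < r & sigma (ball o r) != 0%E) ->
  forall r0, 0 < r0 -> exists k, 0 < rN o (2 ^+ k * r0).
Proof.
move=> [r r_gt0 sr] r0 r0_gt0; exists (Num.truncn (r / r0)).+1.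
set r' := _ * r0.
have rr' : r <= r'.
  rewrite -ler_pdivrMr// (@le_trans _ _ (Num.truncn (r / r0)).+1%:R)//.
    exact/ltW/truncnS_gt.
  by rewrite -natrX ler_nat ltnW// ltn_expl.
have r'0 := lt_le_trans r_gt0 rr'.
rewrite lt_neqAle rN_ge0 andbT eq_sym; apply: contra sr => /eqP /(rN_eq0 r'0) s0.
rewrite -measure_le0 -s0 le_measure ?inE//; [exact: ball_borel..|exact: le_ball].
Qed.

Lemma condition_i_integrandE o t : 0 < t ->
  (poweR (tail mu o t) (q - 1) * (sigma (ball o t) / mu (ball o t)) * t%:E =
   (rtail o t `^ p)%:E * sigma (ball o t) * (rho o t)%:E)%E.
Proof.
move=> t0; rewrite (rtailE mu_regular)// poweR_EFin -!muleA; congr (_ * (_ * _))%E.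
by rewrite muleC (radial_densityE mu_regular).
Qed.

Lemma rtail_powR_measurable o a (b : itv_bound R) : 0 < a ->
  measurable_fun [set` Interval (BRight a) b] (fun t => rtail o t `^ p).
Proof.
(* Truncation at [a] keeps the radius positive, where [rtail] is known to be nonincreasing. *)
move=> a0; apply: (@eq_measurable_fun _ _ _ _ _ (fun t => rtail o (Num.max a t) `^ p)).
  move=> t; rewrite inE/= => tab; rewrite max_r//.
  by move: tab; rewrite itv_boundlr => /andP[+ _]; rewrite bnd_simp => /ltW.
apply: measurable_funTS.
apply: (@nonincreasing_measurable R setT (fun t : R => rtail o (Num.max a t) `^ p)).
  exact: measurableT.
move=> s t st; have am v : 0 < Num.max a v by rewrite lt_max a0.
apply: le_powR2r; [exact: ltW|exact: (rtail_ge0 mu_regular)|].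
apply: (rtail_nonincreasing mu_regular) => //.
by rewrite ge_max !le_max lexx st orbT.
Qed.

Let integrand o t := ((rtail o t `^ p)%:E * sigma (ball o t))%E.

Let integrand_measurable o a (b : itv_bound R) : 0 < a ->
  measurable_fun [set` Interval (BRight a) b] (integrand o).
Proof.
move=> a0; apply: emeasurable_funM; last exact: sigma_ball_measurable.
by apply/measurable_EFinP; exact: rtail_powR_measurable.
Qed.

Lemma integrand_interval_le o a b : 0 < a -> a <= b ->
  (\int[lebesgue_measure]_(t in `]a, b]) (integrand o t * (rho o t)%:E) <=
   (rtail o a `^ p * S o b * (rtail o a - rtail o b))%:E)%E.
Proof.
move=> a0 ab; apply: (integral_density_le mu_regular) => //.
- by rewrite mulr_ge0 ?powR_ge0.
- exact: integrand_measurable.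
- move=> t tab; have /andP[s1 s2] := sigma_ball_le_in o (lt_le_trans a0 ab) tab.
  move: tab; rewrite in_itv/= => /andP[at_ tb].
  have p0 : (0 <= (rtail o t `^ p)%:E)%E by rewrite lee_fin powR_ge0.
  apply/andP; split; first exact: mule_ge0.
  rewrite (EFinM (rtail o a `^ p) (S o b)).
  apply: (lee_pmul p0 s1 _ s2); rewrite lee_fin.
  apply: le_powR2r; first exact: ltW.
    by rewrite (rtail_ge0 mu_regular)// (lt_trans a0).
  by apply: (rtail_nonincreasing mu_regular) => //; exact: ltW.
Qed.

Let K1 : R := A `^ q * (k0 `^ (- q) / p).

(** On the shell, u >= k0 T N with T and N at radius 2a, so (k0 T N)^q times its sigma-mass is at
    most its energy N(2a) - N(a). Convexity makes this telescope, and A^q replaces T(2a) by T(a). *)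
Lemma shell_bound o a : 0 < a -> 0 < rN o a ->
  (S o (2 * a) - S o a) * rtail o a `^ q <=
  K1 * (rN o a `^ (- p) - rN o (2 * a) `^ (- p)).
Proof.
move=> a0 N0; have a2 : a <= 2 * a by rewrite ler_peMl ?(ltW a0)// ler1n.
have s0 : 0 < 2 * a by rewrite mulr_gt0.
pose B : set (borel M) := ball o (2 * a) `\` ball o a.
have mB : measurable B by apply: measurableD; exact: ball_borel.
have DU : (ball o (2 * a) : set (borel M)) = ball o a `|` B.
  by rewrite setDUK//; exact: le_ball.
have disj : [disjoint ball o a & B].
  by rewrite disj_set2E setDIK.
have SB : sigma B = (S o (2 * a) - S o a)%:E.
  have : sigma (ball o (2 * a)) = (sigma (ball o a) + sigma B)%E.
    rewrite DU measureU//; first exact: ball_borel.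
    by apply/eqP; rewrite -disj_set2E.
  by rewrite !sigmaE// EFinB => ->; rewrite addeAC subee ?add0e.
have NB : (\int[sigma]_(y in B) (u y `^ q)%:E = (rN o (2 * a) - rN o a)%:E)%E.
  have : energy o (2 * a) = (energy o a + \int[sigma]_(y in B) (u y `^ q)%:E)%E.
    rewrite /energy DU ge0_integral_setU//; first exact: ball_borel.
    by move=> y _; rewrite lee_fin powR_ge0.
  by rewrite !energyE// EFinB => ->; rewrite addeAC subee ?add0e.
set N := rN o (2 * a) in NB *; set T := rtail o (2 * a).
have NN : rN o a <= N.
  by rewrite -subr_ge0 -lee_fin -NB; apply: integral_ge0 => y _; rewrite lee_fin powR_ge0.
have Np := lt_le_trans N0 NN.
have T0 : 0 < T by rewrite (rtail_gt0 mu_regular).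
have kTN : 0 <= k0 * (T * N).
  by apply: mulr_ge0; [exact: ltW|apply: mulr_ge0; exact: ltW].
have h : (k0 * (T * N)) `^ q * (S o (2 * a) - S o a) <= N - rN o a.
  rewrite -lee_fin EFinM -SB -NB; apply: sigma_set_le => // y [+ _].
  rewrite in_ball => oy; exact: (dyadic_potential_le 0 s0 oy).
have Sd : 0 <= S o (2 * a) - S o a by rewrite -lee_fin -SB.
have := powR_lt0_decrement p_gt0 N0 NN.
rewrite (_ : p + 1 = q) ?subrK// => h2.
apply: (@le_trans _ _ ((S o (2 * a) - S o a) * (A `^ q * T `^ q))).
  rewrite ler_wpM2l// -powRM ?(ltW A_gt0) ?(ltW T0)//.
  rewrite le_powR2r ?(ltW q_gt0) ?(rtail_ge0 mu_regular)//.
  exact: (rtail_double mu_regular).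
rewrite /K1 mulrCA -mulrA; apply: ler_wpM2l; first exact: powR_ge0.
apply: (@le_trans _ _ (k0 `^ (- q) * ((N - rN o a) * N `^ (- q)))); last first.
  by rewrite (le_trans (ler_wpM2l (powR_ge0 _ _) h2))// !mulrA lexx.
rewrite (powRM _ (ltW k0_gt0)) ?(powRM _ (ltW T0) (ltW Np)) in h; last first.
  by apply: mulr_ge0; exact: ltW.
rewrite !powRN mulrCA -invfM ler_pdivlMr ?mulr_gt0 ?powR_gt0//.
by apply: le_trans h; rewrite le_eqVlt; apply/orP; left; apply/eqP; ring.
Qed.

(** Summation by parts as an induction: the boundary term S T^q at the outer radius is carried on
    the left, and each new shell is paid for by [shell_bound]. *)
Lemma dyadic_condition_i o a k : 0 < a -> 0 < rN o a ->
  (\int[lebesgue_measure]_(t in `]a, (2 ^+ k * a)%R]) (integrand o t * (rho o t)%:E)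
    + (S o (2 ^+ k * a) * rtail o (2 ^+ k * a) `^ q)%:E <=
   (S o a * rtail o a `^ q +
    K1 * (rN o a `^ (- p) - rN o (2 ^+ k * a) `^ (- p)))%:E)%E.
Proof.
move=> a0 N0; elim: k => [|k IH].
  by rewrite expr0 !mul1r set_itvoc0 integral_set0 subrr mulr0 addr0 add0e.
set b := 2 ^+ k * a in IH *.
have e : 2 ^+ k.+1 * a = 2 * b by rewrite exprS mulrA.
have ab : a <= b by rewrite ler_peMl ?(ltW a0)// exprn_ege1// ler1n.
clearbody b; have b0 := lt_le_trans a0 ab.
have b2 : b <= 2 * b by rewrite ler_peMl ?(ltW b0)// ler1n.
have b20 := lt_le_trans b0 b2.
have Nb : 0 < rN o b.
  rewrite (lt_le_trans N0)// -lee_fin -!energyE//.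
  apply: ge0_subset_integral => //; [exact: ball_borel..| |exact: le_ball].
  by move=> y _; rewrite lee_fin powR_ge0.
rewrite e.
have -> := @ge0_integral_itv_split R a b (BRight (2 * b))
  (fun t => integrand o t * (rho o t)%:E)%E ab; last 3 first.
- by rewrite bnd_simp.
- apply: emeasurable_funM; first exact: integrand_measurable.
  by apply/measurable_EFinP; apply: measurable_funS (radial_density_measurable mu_regular o).
- move=> t at_; apply: mule_ge0.
    by apply: mule_ge0 => //; rewrite lee_fin powR_ge0.
  by rewrite lee_fin radial_density_ge0// ltW// (lt_trans a0).
have h1 := integrand_interval_le o b0 b2.
have h2 := shell_bound b0 Nb.
have T0 := rtail_gt0 mu_regular o b0; have T20 := rtail_gt0 mu_regular o b20.
(* As q = p + 1 and T^p is nonincreasing, the bound on the integral over []b, 2b]] and the new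
   boundary term add up to at most S(2b) T(b)^q. *)
have h3 : rtail o b `^ p * S o (2 * b) * (rtail o b - rtail o (2 * b)) +
    S o (2 * b) * rtail o (2 * b) `^ q <= S o (2 * b) * rtail o b `^ q.
  rewrite -(mulr_powRB1 (ltW T0) q_gt0) -(mulr_powRB1 (ltW T20) q_gt0) -/p.
  have : rtail o (2 * b) `^ p <= rtail o b `^ p.
    rewrite le_powR2r ?(ltW p_gt0) ?(ltW T20)//.
    exact: (rtail_nonincreasing mu_regular).
  have alg (s t t' P P' : R) : 0 <= s -> 0 <= t' -> P' <= P ->
      P * s * (t - t') + s * (t' * P') <= s * (t * P).
    move=> s0 t'0 PP; rewrite -subr_ge0.
    have -> : s * (t * P) - (P * s * (t - t') + s * (t' * P')) = s * t' * (P - P') by ring.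
    by rewrite !mulr_ge0// subr_ge0.
  by apply: alg; rewrite ?(ltW T20).
have comb (I J : \bar R) (v s t d d' : R) : (J <= v%:E)%E -> v + s <= t + d ->
    (I + t%:E <= d'%:E)%E -> (I + J + s%:E <= (d' + d)%:E)%E.
  move=> Jv vs Id; rewrite -addeA; apply: le_trans (leeD2l I (leeD2r _ Jv)) _.
  rewrite -EFinD; apply: le_trans (leeD2l I (_ : (v + s)%:E <= (t + d)%:E)%E) _.
    by rewrite lee_fin.
  by rewrite EFinD addeA [leRHS]EFinD; apply: leeD2r.
have tele (k' x y z s : R) : s + k' * (x - y) + k' * (y - z) = s + k' * (x - z) by ring.
rewrite -(tele K1 _ (rN o b `^ (- p))).
apply: (comb _ _ _ _ _ _ _ h1 _ IH).
(* [shell_bound] replaces S(2b) T(b)^q by the old boundary term S(b) T(b)^q plus a telescoping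
   difference. *)
by rewrite (le_trans h3)// -lerBlDl -mulrBl.
Qed.

Lemma necessity_i o r0 : 0 < r0 -> condition_i mu sigma q o r0.
Proof.
move=> r0_gt0; rewrite /condition_i.
under eq_integral => t.
  rewrite inE/= in_itv/= andbT => rt.
  rewrite condition_i_integrandE ?(lt_trans r0_gt0 rt)//; over.
have ige0 t : r0 < t -> (0 <= (rtail o t `^ p)%:E * sigma (ball o t) * (rho o t)%:E)%E.
  move=> rt; rewrite mule_ge0 ?mule_ge0 ?lee_fin ?powR_ge0 ?radial_density_ge0//.
  by rewrite ltW ?(lt_trans r0_gt0).
have [[r r_gt0 sr]|nex] := pselect (exists2 r, 0 < r & sigma (ball o r) != 0%E); last first.
  rewrite integral0_eq ?ltry// => t /=; rewrite in_itv/= andbT => rt.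
  have -> : sigma (ball o t) = 0%E.
    apply/eqP/negP => /negP st; apply: nex; exists t => //; exact: lt_trans rt.
  by rewrite mule0 mul0e.
have [k Nk] := exists_energy_gt0 (ex_intro2 _ _ r r_gt0 sr) r0_gt0.
(* From [a] on the energy is positive and the dyadic bound is uniform; []r0, a]] contributes a
   finite amount. *)
set a := 2 ^+ k * r0 in Nk.
have ra : r0 <= a by rewrite ler_peMl ?(ltW r0_gt0)// exprn_ege1// ler1n.
have a0 := lt_le_trans r0_gt0 ra.
have mf (b : R) (e : itv_bound R) : 0 < b -> measurable_fun [set` Interval (BRight b) e]
    (fun t => ((rtail o t `^ p)%:E * sigma (ball o t) * (rho o t)%:E)%E).
  move=> b0; apply: emeasurable_funM; first exact: integrand_measurable.
  by apply/measurable_EFinP; apply: measurable_funS (radial_density_measurable mu_regular o).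
rewrite (ge0_integral_itv_split (e := +oo%O) ra)//; last exact: mf.
apply: lte_add_pinfty.
  by apply: le_lt_trans (integrand_interval_le o r0_gt0 ra) (ltry _).
have -> : `]a, +oo[%classic = \bigcup_n `]a, 2 ^+ n * a]%classic.
  apply/seteqP; split => t /=; last first.
    by move=> [n _] /=; rewrite !in_itv/= andbT => /andP[].
  rewrite in_itv/= andbT => st; exists (Num.truncn (t / a)).+1 => //=.
  rewrite in_itv/= st/= -ler_pdivrMr//.
  apply: (@le_trans _ _ (Num.truncn (t / a)).+1%:R); first exact/ltW/truncnS_gt.
  by rewrite -natrX ler_nat ltnW// ltn_expl.
apply: (@le_lt_trans _ _ (S o a * rtail o a `^ q + K1 * rN o a `^ (- p))%:E); last exact: ltry.
apply: ge0_integral_bigcup_le.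
- move=> m n mn; rewrite subsetEset => t /=; rewrite !in_itv/= => /andP[-> /=] h1.
  by rewrite (le_trans h1)// ler_wpM2r ?(ltW a0)// ler_weXn2l// ler1n.
- by [].
- by move=> n; exact: mf.
- move=> n t /=; rewrite in_itv/= => /andP[st _]; exact/ige0/(le_lt_trans ra).
- move=> n; have := dyadic_condition_i n a0 Nk => h.
  apply: (@le_trans _ _ _ _ _ (le_trans (leeDl _ _) h)).
    by rewrite lee_fin mulr_ge0 ?powR_ge0.
  rewrite lee_fin lerD2l; apply: ler_wpM2l.
    by rewrite mulr_ge0 ?powR_ge0// divr_ge0 ?powR_ge0 ?(ltW p_gt0).
  by rewrite gerBl powR_ge0.
Qed.

Lemma condition_ii_integralE x r :
  (\int[lebesgue_measure]_(s in `]0%R, r[)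
     (sigma (ball x s) / mu (ball x s) * s%:E) =
   \int[lebesgue_measure]_(t in `]0%R, r[) (sigma (ball x t) * (rho x t)%:E))%E.
Proof.
apply: eq_integral => t; rewrite inE/= in_itv/= => /andP[t0 _].
by rewrite -muleA [X in (_ * X)%E]muleC (radial_densityE mu_regular).
Qed.

Lemma necessity_ii o r0 : 0 < r0 -> exists2 C, 0 < C & condition_ii mu sigma q o r0 C.
Proof.
move=> r0_gt0.
have [[r r_gt0 sr]|nex] := pselect (exists2 r, 0 < r & sigma (ball o r) != 0%E); last first.
  exists 1 => // r rr0; rewrite (_ : ereal_sup _ = 0%E) ?mul0e ?lee_fin//.
  have r_gt0 := lt_trans r0_gt0 rr0.
  have s0 t : 0 < t -> sigma (ball o t) = 0%E.
    by move=> t0; apply/eqP/negP => /negP st; apply: nex; exists t.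
  rewrite -[RHS]ereal_sup1; congr ereal_sup; apply/seteqP; split => z /=.
    move=> [x xr <-]; rewrite condition_ii_integralE integral0_eq// => t /=.
    rewrite in_itv/= => /andP[t0 _]; rewrite (_ : sigma _ = 0%E) ?mul0e//.
    apply/eqP; rewrite -measure_le0 -(s0 (r + t)) ?addr_gt0//.
    rewrite le_measure ?inE//; [exact: ball_borel..|].
    by move=> y; exact: ball_triangle xr.
  move=> ->; exists o; first by rewrite in_ball mdistxx.
  rewrite condition_ii_integralE integral0_eq// => t /=.
  by rewrite in_itv/= => /andP[t0 _]; rewrite s0// mul0e.
have [k Nk] := exists_energy_gt0 (ex_intro2 _ _ r r_gt0 sr) r0_gt0.
set n0 := rN o _ in Nk.
(* The cost of comparing the tail at o of r with the tail at x of 2^(k+1) r: k + 1 doublings and one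
   change of centre. *)
pose B := D * A ^+ k.+1.
have B0 : 0 < B by rewrite mulr_gt0// exprn_gt0.
have K0 : 0 < K by rewrite divr_gt0// mulr_gt0 ?exprn_gt0 ?powR_gt0.
exists (K * (n0 / B) `^ (- p)); first by rewrite (mulr_gt0 K0)// powR_gt0// divr_gt0.
move=> {r r_gt0 sr} r rr0; have r_gt0 := lt_trans r0_gt0 rr0.
have Tr := rtail_gt0 mu_regular o r_gt0.
rewrite (rtailE mu_regular)// poweR_EFin -/p -lee_pdivlMr ?powR_gt0//.
apply: ge_ereal_sup => _ [x /= + <-]; rewrite in_ball => ox.
rewrite condition_ii_integralE -EFinM.
(* Both d(o, x) and 2^k r0 are at most b, so B(x, 2b) contains the ball around o of energy n0: the
   lower bound on the energy is uniform in x. *)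
pose b := 2 ^+ k * r.
have rb : r <= b by rewrite ler_peMl ?(ltW r_gt0)// exprn_ege1// ler1n.
have b0 := lt_le_trans r_gt0 rb; have b20 : 0 < 2 * b by rewrite mulr_gt0.
have bb : b <= 2 * b by rewrite ler_peMl ?(ltW b0)// ler1n.
have N1 : n0 <= rN x (2 * b).
  rewrite -lee_fin -!energyE ?mulr_gt0 ?exprn_gt0//.
  apply: ge0_subset_integral => //; [exact: ball_borel..| |].
    by move=> y _; rewrite lee_fin powR_ge0.
  move=> y; rewrite !in_ball => oy.
  have ob : mdist o y < b by rewrite (lt_le_trans oy)// ler_wpM2l ?exprn_ge0// ltW.
  have xb : mdist x o < b by rewrite metric_sym (lt_le_trans ox).
  by rewrite (le_lt_trans (metric_triangle x o y))// mulr_natl mulr2n ltrD.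
have T1 : rtail o r / B <= rtail x (2 * b).
  rewrite ler_pdivrMr// (le_trans (rtail_expn mu_regular o k.+1 r_gt0))//.
  have -> : 2 ^+ k.+1 * r = 2 * b by rewrite exprS -mulrA.
  have xo : mdist o x <= 2 * b by rewrite (le_trans (ltW ox))// (le_trans rb).
  have Ak : 0 <= A ^+ k.+1 by rewrite exprn_ge0// ltW.
  apply: le_trans (ler_wpM2l Ak (rtail_center mu_regular b20 xo)) _.
  by rewrite mulrCA mulrA mulrC.
have N2 := lt_le_trans Nk N1.
apply: le_trans (_ : (\int[lebesgue_measure]_(t in `]0%R, b]) (sigma (ball x t) * (rho x t)%:E) <= _)%E).
  apply: ge0_subset_integral => //.
  - apply: emeasurable_funM; first exact: sigma_ball_measurable.
    by apply/measurable_EFinP; apply: measurable_funS (radial_density_measurable mu_regular x).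
  - move=> t /=; rewrite in_itv/= => /andP[t0 _].
    by rewrite mule_ge0// lee_fin radial_density_ge0// ltW.
  - move=> t /=; rewrite !in_itv/= => /andP[-> /ltW tr] /=; exact: le_trans tr rb.
apply: le_trans (wolff_potential_bound b0 N2) _; rewrite lee_fin.
have nB : 0 < n0 / B by rewrite divr_gt0.
rewrite -(mulrA K) -(powRN (rtail o r)); apply: ler_wpM2l; first exact: ltW.
rewrite -(powRM _ (ltW nB) (ltW Tr)) !powRN lef_pV2 ?posrE; last 2 first.
- by rewrite powR_gt0// mulr_gt0// (rtail_gt0 mu_regular).
- by rewrite powR_gt0// (mulr_gt0 nB).
apply: le_powR2r; [exact: ltW|by apply: mulr_ge0; exact: ltW|].
rewrite mulrAC (mulrC n0) mulrAC.
by apply: ler_pM => //; [rewrite divr_ge0// ltW|exact: ltW].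
Qed.

End necessity.

(** * Sigma-finite copies of a measure *)

Section sigma_finite_measure_of.
Context d (T : measurableType d) (R : realType) (m : {measure set T -> \bar R}).

(** An alias of [m] indexed by the proof of sigma-finiteness, on which the structure expected by
    Tonelli's theorem can be declared. *)
Definition sigma_finite_of & sigma_finite setT m : set T -> \bar R := m.

Hypothesis m_sigma_finite : sigma_finite setT m.
Local Notation m' := (sigma_finite_of m_sigma_finite).

HB.instance Definition _ := isMeasure.Build _ _ _ m' (measure0 m) (measure_ge0 m)
  (@measure_semi_sigma_additive _ _ _ m).

HB.instance Definition _ := Measure_isSigmaFinite.Build _ _ _ m' m_sigma_finite.
End sigma_finite_measure_of.

(** * Tonelli over the region d(x, y) < t *)

Section ball_fubini.
Context {R : realType} {M : completeMetricType R}.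
Variables (sigma : {measure set (borel M) -> \bar R}) (x : M).
Hypothesis sigma_ball_fin : forall r, (sigma (ball x r) < +oo)%E.
Variables (B : set R) (f : R -> \bar R).
Hypotheses (mB : measurable B) (mf : measurable_fun B f)
  (f0 : forall t, B t -> (0 <= f t)%E).

(** Integrated in t it gives the integral of f over the radii of [B] beyond d(x, y); integrated in
    y, it gives f(t) sigma(B(x, t)) for t in [B]. *)
Let layer (z : borel M * R) : \bar R :=
  ((f \_ B) z.2 * (\1_[set w : borel M * R | (mdist x w.1 < w.2)%R] z)%:E)%E.

Let fB0 t : (0 <= (f \_ B) t)%E.
Proof. exact: erestrict_ge0. Qed.

Let layer_ge0 z : (0 <= layer z)%E.
Proof. by rewrite mule_ge0// lee_fin. Qed.

Let mfB : measurable_fun setT (f \_ B).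
Proof. by apply/(measurable_restrictT f mB). Qed.

Let measurable_layer : measurable_fun setT layer.
Proof.
apply: emeasurable_funM; first exact: (measurableT_comp mfB measurable_snd).
apply/measurable_EFinP; apply: measurable_indic.
have mg : measurable_fun setT (fun w : borel M * R => w.2 - mdist x w.1).
  apply: measurable_funB; first exact: measurable_snd.
  exact: (measurableT_comp (mdist_borel x) measurable_fst).
have := mg measurableT `]0, +oo[%classic (measurable_itv _).
congr (measurable _); apply/seteqP.
by split => w /=; rewrite in_itv/= andbT subr_gt0; [case|].
Qed.

Let sigma_sigma_finite : sigma_finite setT sigma.
Proof.
exists (fun n : nat => (ball x n%:R : set (borel M))); first by rewrite bigcup_ball.
by move=> n; split; [exact: ball_borel|exact: sigma_ball_fin].
Qed.

Let inner_integral y : (\int[lebesgue_measure]_t layer (y, t) =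
  \int[lebesgue_measure]_(t in B `&` `]mdist x y, +oo[) f t)%E.
Proof.
rewrite [RHS]integral_mkcond; apply: eq_integral => t _; rewrite /layer/= !patchE indicE.
have -> : ((y, t) \in [set w : borel M * R | mdist x w.1 < w.2]) = (mdist x y < t).
  by apply/idP/idP; rewrite inE.
rewrite in_setI; case: (t \in B) => /=; last by rewrite mul0e.
have -> : (t \in [set` `]mdist x y, +oo[]) = (mdist x y < t).
  by apply/idP/idP; rewrite inE/= in_itv/= andbT.
by case: ifP => _; rewrite ?mule1 ?mule0.
Qed.

Lemma layer_integral_measurable : measurable_fun [set: borel M]
  (fun y => \int[lebesgue_measure]_(t in B `&` `]mdist x y, +oo[) f t)%E.
Proof.
under eq_fun do rewrite -inner_integral.
exact: (@measurable_fun_fubini_tonelli_F _ _ _ _ _ lebesgue_measure layer).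
Qed.

Lemma layer_fubini :
  (\int[sigma]_(y in [set: borel M])
     \int[lebesgue_measure]_(t in B `&` `]mdist x y, +oo[) f t =
   \int[lebesgue_measure]_(t in B) (f t * sigma (ball x t)))%E.
Proof.
under eq_integral do rewrite -inner_integral.
have := @fubini_tonelli _ _ _ _ _ (sigma_finite_of sigma_sigma_finite) lebesgue_measure
  layer measurable_layer layer_ge0.
rewrite /= => ->; rewrite [RHS]integral_mkcond; apply: eq_integral => t _.
have mb : measurable_fun [set: borel M] (\1_(ball x t : set (borel M)) : borel M -> R).
  by apply: measurable_indic; exact: ball_borel.
transitivity (\int[sigma]_(y in [set: borel M])
    ((f \_ B) t * (\1_(ball x t : set (borel M)) y)%:E))%E.
  apply: eq_integral => y _; rewrite /layer/= !indicE; congr (_ * (nat_of_bool _)%:R%:E)%E.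
  by apply/idP/idP; rewrite !inE in_ball.
rewrite ge0_integralZl//; last exact/measurable_EFinP.
rewrite integral_indic//; last exact: ball_borel.
rewrite setIT !patchE; case: ifP => // _; by rewrite mul0e.
Qed.

End ball_fubini.

(** * Sufficiency: bounds on the radial kernel from (i) and (ii) *)

Section sufficiency.
Context {R : realType} {M : completeMetricType R}.
Variables (mu : {measure set (borel M) -> \bar R}) (D : R).
Hypothesis mu_regular : regular_volume mu D.
Variables (sigma : {measure set (borel M) -> \bar R}) (q : R).
Hypothesis q_gt1 : 1 < q.
Variables (o : M) (r0 C : R).
Hypotheses (r0_gt0 : 0 < r0) (cond_i : condition_i mu sigma q o r0)
  (cond_ii : condition_ii mu sigma q o r0 C).

Local Notation rho := (radial_density mu).
Local Notation rtail := (real_tail mu).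
Let A : R := D ^+ 2 + 1.
Let p : R := q - 1.

Let q_gt0 : 0 < q. Proof. exact: lt_trans q_gt1. Qed.
Let p_gt0 : 0 < p. Proof. by rewrite subr_gt0. Qed.
Let A_ge1 : 1 <= A. Proof. by rewrite /A lerDr sqr_ge0. Qed.
Let A_gt0 : 0 < A. Proof. exact: lt_le_trans A_ge1. Qed.
Let D_gt0 : 0 < D. Proof. by case: mu_regular. Qed.

(** The function h of the overview; the maximum with [r0] keeps it bounded. *)
Definition profile (y : M) : R := rtail o (Num.max (mdist o y) r0).

Let max_gt0 t : 0 < Num.max t r0. Proof. by rewrite lt_max r0_gt0 orbT. Qed.

Lemma profile_gt0 y : 0 < profile y.
Proof. exact: (rtail_gt0 mu_regular). Qed.

Lemma profile_measurable : measurable_fun [set: borel M] (profile : borel M -> R).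
Proof.
apply: (@measurableT_comp _ _ _ _ _ _ (fun t : R => rtail o (Num.max t r0)));
  last exact: mdist_borel.
apply: (@nonincreasing_measurable R setT (fun t : R => rtail o (Num.max t r0))).
  exact: measurableT.
move=> s t st; apply: (rtail_nonincreasing mu_regular) => //.
by rewrite ge_max !le_max lexx st orbT.
Qed.

Let profile_pow_measurable :
  measurable_fun [set: borel M] (fun y => (profile y `^ q)%:E : \bar R).
Proof.
apply/measurable_EFinP.
exact: (measurableT_comp (measurable_powR q) profile_measurable).
Qed.

Let integrand t := ((rtail o t `^ p)%:E * (rho o t)%:E)%E.

Let integrand_measurable (a : R) (b : itv_bound R) : 0 < a ->
  measurable_fun [set` Interval (BRight a) b] integrand.
Proof.
move=> a0; apply: emeasurable_funM; apply/measurable_EFinP.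
  exact: (rtail_powR_measurable mu_regular).
by apply: measurable_funS (radial_density_measurable mu_regular o).
Qed.

Let integrand_ge0 t : 0 <= t -> (0 <= integrand t)%E.
Proof. by move=> t0; rewrite mule_ge0// lee_fin ?powR_ge0// radial_density_ge0. Qed.

Let cond_i_integral : (\int[lebesgue_measure]_(t in `]r0, +oo[)
  (integrand t * sigma (ball o t)) < +oo)%E.
Proof.
move: cond_i; rewrite /condition_i.
under eq_integral => t.
  rewrite inE/= in_itv/= andbT => rt.
  rewrite (condition_i_integrandE mu_regular) ?(lt_trans r0_gt0 rt)// muleAC; over.
by [].
Qed.

Let sigma_le s t : s <= t -> (sigma (ball o s) <= sigma (ball o t))%E.
Proof. by move=> st; rewrite le_measure ?inE//; [exact: ball_borel..|exact: le_ball]. Qed.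

(** If a ball of radius s > r0 had infinite mass, the integrand of (i) would be infinite on []s,
    2s]], which has positive m_o-mass. *)
Lemma cond_i_sigma_ball_lty r : (sigma (ball o r) < +oo)%E.
Proof.
pose s := Num.max r (2 * r0).
have rs : r0 < s by rewrite lt_max ltr_pMl// ltr1n orbT.
have s0 := lt_trans r0_gt0 rs; have s2 : s <= 2 * s by rewrite ler_peMl ?(ltW s0)// ler1n.
apply: le_lt_trans (sigma_le (_ : r <= s)) _; first by rewrite le_max lexx.
rewrite ltNge leye_eq; apply/negP => /eqP soo.
set d := rtail o s - rtail o (2 * s).
have d0 : 0 < d.
  apply: lt_le_trans (rtail_decrement_ge mu_regular o s0).
  by rewrite divr_gt0 ?exprn_gt0// (vol_gt0 mu_regular)// mulr_gt0.
set I := (\int[lebesgue_measure]_(t in `]r0, +oo[) (integrand t * sigma (ball o t)))%E.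
have I0 : (0 <= I)%E.
  apply: integral_ge0 => t /=; rewrite in_itv/= andbT => rt.
  by rewrite mule_ge0// integrand_ge0// ltW// (lt_trans r0_gt0).
have If : I \is a fin_num by rewrite ge0_fin_numE// cond_i_integral.
have fI : 0 <= fine I by rewrite fine_ge0.
(* Multiplied by the mass d of []s, 2s]], this constant exceeds the whole integral by 1. *)
have c0 : 0 <= (fine I + 1) / d by rewrite divr_ge0 ?(ltW d0)// addr_ge0.
have : ((((fine I + 1) / d) * d)%:E <= I)%E.
  have := integral_density_ge mu_regular o
    (f := fun t => ((rtail o t `^ p)%:E * sigma (ball o t))%E) s0 s2 c0.
  move=> lb; apply: le_trans (lb _) _.
    move=> t; rewrite in_itv/= => /andP[st _].
    have -> : sigma (ball o t) = +oo%E.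
      by apply/eqP; rewrite -leye_eq -soo; apply: sigma_le; exact: ltW.
    by rewrite gt0_muley ?leey// lte_fin powR_gt0// (rtail_gt0 mu_regular)// (lt_trans s0).
  apply: le_trans (_ : \int[lebesgue_measure]_(t in `]s, (2 * s)%R]) (integrand t * sigma (ball o t)) <= _)%E.
    apply: ge0_le_integral_any => t /=; rewrite in_itv/= => /andP[st _]; last by rewrite muleAC.
    rewrite mule_ge0 ?mule_ge0 ?lee_fin ?powR_ge0 ?radial_density_ge0//.
    exact: ltW (lt_trans s0 st).
  apply: ge0_subset_integral => //.
  - apply: emeasurable_funM; first exact: integrand_measurable.
    exact: sigma_ball_measurable.
  - move=> t /=; rewrite in_itv/= andbT => rt.
    by rewrite mule_ge0// integrand_ge0// ltW// (lt_trans r0_gt0).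
  - by move=> t /=; rewrite !in_itv/= andbT => /andP[st _]; exact: lt_trans st.
rewrite divfK ?gt_eqF// -[leRHS]fineK// lee_fin; lra.
Qed.

(* The tail is halved after finitely many doublings; on the dyadic interval
   just before that it stays comparable to its initial value. *)
Lemma rtail_powR_le_integral s : 0 < s ->
  ((rtail o s `^ q)%:E <= (2 * (2 * A) `^ p)%:E *
     \int[lebesgue_measure]_(t in `]s, +oo[) integrand t)%E.
Proof.
move=> s0; have [k hk kmin] := ex_minnP (rtail_halving mu_regular o s0).
have T0 := rtail_gt0 mu_regular o s0.
have k0 : (0 < k)%N.
  rewrite lt0n; apply/eqP => k0; move: hk; rewrite k0 expr0 mul1r.
  by rewrite ler_pdivlMr// ger_pMr// leNgt ltr1n.
have hj : rtail o s / 2 < rtail o (2 ^+ k.-1 * s).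
  rewrite ltNge; apply/negP => /kmin; rewrite leqNgt => /negP; apply.
  by rewrite prednK.
set v := rtail o (2 ^+ k * s) in hk.
have ks0 : 0 < 2 ^+ k * s by rewrite mulr_gt0// exprn_gt0.
have ks : s <= 2 ^+ k * s by rewrite ler_peMl ?(ltW s0)// exprn_ege1// ler1n.
(* By minimality of k the tail at 2^(k-1) s exceeds T(s) / 2, and one more doubling divides it by at
   most A. *)
have hv : rtail o s / (2 * A) <= v.
  have := rtail_double mu_regular o (_ : 0 < 2 ^+ k.-1 * s).
  rewrite mulrA -exprS prednK// -/v -/A => /(_ _)hA.
  rewrite invfM mulrA ler_pdivrMr// [leRHS]mulrC (le_trans (ltW hj))//.
  by apply: hA; rewrite mulr_gt0// exprn_gt0.
have A20 : 0 < 2 * A by rewrite mulr_gt0.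
have v0 : 0 < rtail o s / (2 * A) by rewrite divr_gt0.
set c := (rtail o s / (2 * A)) `^ p.
have c0 : 0 < c by rewrite powR_gt0.
apply: (@le_trans _ _ ((2 * (2 * A) `^ p) * (c * (rtail o s - v)))%:E).
  rewrite lee_fin -(mulr_powRB1 (ltW T0) q_gt0) -/p.
  have -> : rtail o s `^ p = (2 * A) `^ p * c.
    by rewrite -powRM ?(ltW A20) ?(ltW v0)// mulrC divfK ?gt_eqF.
  have alg (x y z w : R) : x * y * (z * w) = y * z * (x * w) by ring.
  rewrite alg mulrC; apply: ler_wpM2l; first by rewrite mulr_ge0 ?powR_ge0// ltW.
  by move: hk; rewrite ler_pdivlMr//; lra.
rewrite EFinM; apply: lee_wpmul2l; first by rewrite lee_fin mulr_ge0 ?powR_ge0.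
apply: le_trans (integral_density_ge mu_regular o (f := fun t => (rtail o t `^ p)%:E) s0 ks (ltW c0) _) _.
  move=> t; rewrite in_itv/= => /andP[st tk]; rewrite lee_fin; apply: le_powR2r.
  - exact: ltW.
  - exact: ltW.
  - apply: (le_trans hv); apply: (rtail_nonincreasing mu_regular) => //.
    exact: lt_trans st.
apply: ge0_subset_integral => //.
- exact: integrand_measurable.
- by move=> t /=; rewrite in_itv/= andbT => st; rewrite integrand_ge0// ltW// (lt_trans s0).
- by move=> t /=; rewrite !in_itv/= andbT => /andP[].
Qed.

(** Pointwise, h^q is at most a multiple of the integral of T^p against m_o beyond max (d(o, y),
    r0); Tonelli turns its sigma-integral into the one of (i). *)
Lemma profile_energy_lty :
  (\int[sigma]_(y in [set: borel M]) (profile y `^ q)%:E < +oo)%E.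
Proof.
set c := 2 * (2 * A) `^ p.
have c0 : 0 <= c by rewrite mulr_ge0// powR_ge0.
have mr := @integrand_measurable r0 +oo%O r0_gt0.
have ir0 t : `]r0, +oo[%classic t -> (0 <= integrand t)%E.
  by rewrite /= in_itv/= andbT => rt; rewrite integrand_ge0// ltW// (lt_trans r0_gt0).
apply: (@le_lt_trans _ _ (\int[sigma]_(y in [set: borel M])
  (c%:E * \int[lebesgue_measure]_(t in `]r0, +oo[ `&` `]mdist o y, +oo[) integrand t))%E).
  apply: ge0_le_integral_any => y _; first by rewrite lee_fin powR_ge0.
  rewrite (_ : _ `&` _ = `]Num.max (mdist o y) r0, +oo[%classic).
    exact: rtail_powR_le_integral.
  apply/seteqP; split => t /=; rewrite !in_itv/= !andbT gt_max.
    by move=> [-> ->].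
  by move=> /andP[-> ->].
rewrite ge0_integralZl_EFin//; last 2 first.
- by move=> y _; apply: integral_ge0 => t [rt _]; exact: ir0.
- by apply: layer_integral_measurable => //; exact: cond_i_sigma_ball_lty.
rewrite layer_fubini//; last exact: cond_i_sigma_ball_lty.
by rewrite lte_mul_pinfty// cond_i_integral.
Qed.

(** Condition (ii) is applied at 2r, since it concerns radii strictly above [r0] and open balls;
    going back to r costs A^p. *)
Lemma cond_ii_wolff x r : r0 <= r -> mdist o x <= r ->
  (\int[lebesgue_measure]_(t in `]0%R, r]) ((rho x t)%:E * sigma (ball x t)) *
     (rtail o r `^ p)%:E <= (A `^ p * C)%:E)%E.
Proof.
move=> rr xr; have r_gt0 := lt_le_trans r0_gt0 rr.
have r2 : r < 2 * r by rewrite ltr_pMl// ltr1n.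
have r20 := lt_trans r_gt0 r2.
have := cond_ii (le_lt_trans rr r2).
rewrite (rtailE mu_regular)// poweR_EFin -/p => cii.
set W := (\int[_]_(t in _) _)%E.
have W0 : (0 <= W)%E.
  apply: integral_ge0 => t /=; rewrite in_itv/= => /andP[t0 _].
  by rewrite mule_ge0// lee_fin radial_density_ge0// ltW.
have WC : (W * (rtail o (2 * r) `^ p)%:E <= C%:E)%E.
  apply: le_trans cii; apply: lee_wpmul2r; first by rewrite lee_fin powR_ge0.
  apply: (@le_trans _ _ (\int[lebesgue_measure]_(s in `]0%R, (2 * r)%R[)
     (sigma (ball x s) / mu (ball x s) * s%:E))%E); last first.
    apply: ereal_sup_ubound; exists x => //; rewrite in_ball.
    exact: le_lt_trans r2.
  rewrite (condition_ii_integralE mu_regular).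
  under [leRHS]eq_integral do rewrite muleC.
  apply: ge0_subset_integral => //.
  - apply: emeasurable_funM; last exact: sigma_ball_measurable.
    by apply/measurable_EFinP; apply: measurable_funS (radial_density_measurable mu_regular x).
  - move=> t /=; rewrite in_itv/= => /andP[t0 _].
    by rewrite mule_ge0// lee_fin radial_density_ge0// ltW.
  - by move=> t /=; rewrite !in_itv/= => /andP[-> tr] /=; exact: le_lt_trans r2.
apply: (@le_trans _ _ (W * ((A `^ p)%:E * (rtail o (2 * r) `^ p)%:E))%E).
  apply: lee_wpmul2l => //; rewrite -EFinM lee_fin -powRM ?(ltW A_gt0) ?(rtail_ge0 mu_regular)//.
  apply: le_powR2r; [exact: ltW|exact: (rtail_ge0 mu_regular)|].
  exact: (rtail_double mu_regular).
by rewrite muleCA EFinM; apply: lee_wpmul2l => //; rewrite lee_fin powR_ge0.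
Qed.

(** The mass m_x(]d(x, y), r]) of the overview, written as an intersection to fit [layer_fubini]. *)
Let local_kernel x y : \bar R :=
  (\int[lebesgue_measure]_(t in `]0%R, (Num.max (mdist o x) r0)] `&` `]mdist x y, +oo[) (rho x t)%:E)%E.

Let local_kernel_ge0 x y : (0 <= local_kernel x y)%E.
Proof.
apply: integral_ge0 => t [/=]; rewrite in_itv/= => /andP[t0 _] _.
by rewrite lee_fin radial_density_ge0// ltW.
Qed.

Lemma kernel_profile_le x y :
  (tail mu x (mdist x y) * (profile y `^ q)%:E <=
   ((A * D) * profile x)%:E * (profile y `^ q)%:E +
   ((A * profile x) `^ q)%:E * local_kernel x y)%E.
Proof.
set r := Num.max (mdist o x) r0; have rp : 0 < r by exact: max_gt0.
have r2 : 0 < r / 2 by rewrite divr_gt0.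
have hx : profile x = rtail o r by [].
have xo : mdist x o <= r by rewrite metric_sym le_max lexx.
have xr : rtail x r <= D * profile x by rewrite hx; exact: (rtail_center mu_regular).
have half z : rtail z (r / 2) <= A * rtail z r.
  by have := rtail_double mu_regular z r2; rewrite mulrCA divff ?mulr1.
have hq : (0 <= (profile y `^ q)%:E)%E by rewrite lee_fin powR_ge0.
have hx0 := profile_gt0 x.
(* In the far case one doubling and one change of centre bound the kernel by A D h(x). *)
have [far|near] := leP (r / 2) (mdist x y).
  apply: le_trans (leeDl _ _); last by rewrite mule_ge0// lee_fin powR_ge0.
  apply: lee_wpmul2r => //; apply: le_trans (tail_nonincreasing mu_regular x (ltW r2) far) _.
  rewrite (rtailE mu_regular)// lee_fin (le_trans (half x))// -mulrA.
  by apply: ler_wpM2l => //; exact: ltW.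
have rr : mdist x y <= r by rewrite (le_trans (ltW near))// ler_pdivrMr// ler_peMr ?(ltW rp)// ler1n.
(* Here max (d(o, y), r0) >= r / 2: either r = r0, or r = d(o, x) and d(o, y) >= d(o, x) - d(x, y) >
   r / 2. *)
have hy : profile y <= A * profile x.
  apply: le_trans (half o); apply: (rtail_nonincreasing mu_regular) => //.
  rewrite /r ler_pdivrMr//; rewrite ge_max; apply/andP; split; last first.
    by rewrite (@le_trans _ _ (r0 * 2))// ?ler_pM2r ?le_max ?lexx ?orbT// ler_peMr ?ler1n ?ltW.
  have [xr0|xr0] := leP (mdist o x) r0.
    rewrite (le_trans xr0)// (@le_trans _ _ (r0 * 2))// ?ler_pM2r ?le_max ?lexx ?orbT// ler_peMr ?ler1n ?ltW//.
  have rE : r = mdist o x by rewrite /r max_l// ltW.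
  rewrite mulrC -ler_pdivrMl// mulrC le_max; apply/orP; left.
  have := metric_triangle o y x; rewrite (metric_sym y x).
  move: near; rewrite rE; lra.
(* The kernel is cut at radius r: the tail beyond r goes into the first term, and the rest is
   [local_kernel]. *)
have -> : tail mu x (mdist x y) = (local_kernel x y + (rtail x r)%:E)%E.
  rewrite (tailE mu_regular) ?mdist_ge0// (ge0_integral_itv_split (e := +oo%O) rr)//; last 2 first.
  - by apply/measurable_EFinP; apply: measurable_funS (radial_density_measurable mu_regular x).
  - by move=> t dt; rewrite lee_fin radial_density_ge0// ltW// (le_lt_trans (mdist_ge0 x y)).
  rewrite -(rtailE mu_regular)// -(tailE mu_regular) ?(ltW rp)//; congr (_ + _)%E.
  rewrite /local_kernel -/r; congr (integral _ _ _).
  apply/seteqP; split => t /=; rewrite !in_itv/= !andbT.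
    by move=> /andP[dt ->]; rewrite (le_lt_trans (mdist_ge0 x y) dt).
  by move=> [/andP[_ ->] ->].
rewrite ge0_muleDl ?lee_fin ?(rtail_ge0 mu_regular)// addeC.
apply: leeD.
  apply: lee_wpmul2r => //; rewrite lee_fin (le_trans xr)//.
  by apply: ler_wpM2r; [exact: ltW|rewrite ler_peMl ?(ltW D_gt0)].
rewrite muleC; apply: lee_wpmul2r => //; rewrite lee_fin.
by apply: le_powR2r => //; [exact: ltW|exact/ltW/profile_gt0].
Qed.

Lemma kernel_profile_bound : exists2 K, 0 < K & forall x,
  (\int[sigma]_(y in [set: borel M])
     (tail mu x (mdist x y) * (profile y `^ q)%:E) <= (K * profile x)%:E)%E.
Proof.
set J := (\int[sigma]_(y in [set: borel M]) (profile y `^ q)%:E)%E.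
have J0 : (0 <= J)%E by apply: integral_ge0 => y _; rewrite lee_fin powR_ge0.
have JE : J = (fine J)%:E by rewrite fineK// ge0_fin_numE// profile_energy_lty.
(* The sign comes from (ii) itself: A^p C bounds a non-negative quantity at x = o. *)
have C0 : 0 <= A `^ p * C.
  rewrite -lee_fin; apply: le_trans (cond_ii_wolff (x := o) (lexx r0) _); last by rewrite mdistxx ltW.
  rewrite mule_ge0// ?lee_fin ?powR_ge0//; apply: integral_ge0 => t /=; rewrite in_itv/= => /andP[t0 _].
  by rewrite mule_ge0// lee_fin radial_density_ge0// ltW.
(* The first two terms come from the integral of h^q and from (ii); the final 1 makes the constant
   positive. *)
exists (A * D * fine J + A `^ q * (A `^ p * C) + 1).
  by rewrite ltr_wpDl// addr_ge0// mulr_ge0 ?fine_ge0 ?powR_ge0// mulr_ge0 ?ltW.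
move=> x; have hx0 := profile_gt0 x.
set r := Num.max (mdist o x) r0.
have AD : 0 <= A * D * profile x by rewrite !mulr_ge0 ?ltW.
have mrho (B : set R) : measurable_fun B (fun t => (rho x t)%:E : \bar R).
  by apply/measurable_EFinP; apply: measurable_funS (radial_density_measurable mu_regular x).
have rho0 t : `]0%R, r]%classic t -> (0 <= (rho x t)%:E)%E.
  by rewrite /= in_itv/= => /andP[t0 _]; rewrite lee_fin radial_density_ge0// ltW.
have sx s : (sigma (ball x s) < +oo)%E.
  apply: le_lt_trans (cond_i_sigma_ball_lty (mdist o x + s)).
  rewrite le_measure ?inE//; [exact: ball_borel..|] => z; rewrite !in_ball => xz.
  by rewrite (le_lt_trans (metric_triangle o x z))// ltrD2l.
have mlk : measurable_fun [set: borel M] (local_kernel x).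
  exact: layer_integral_measurable.
apply: le_trans (ge0_le_integral_any sigma _ (fun y _ => kernel_profile_le x y)) _.
  by move=> y _; rewrite mule_ge0 ?lee_fin ?powR_ge0// (tail_ge0 mu_regular)// mdist_ge0.
rewrite ge0_integralD//; last 4 first.
- by move=> y _; rewrite mule_ge0// lee_fin powR_ge0.
- exact: measurable_funeM.
- by move=> y _; rewrite mule_ge0// lee_fin powR_ge0.
- exact: measurable_funeM.
rewrite ge0_integralZl_EFin//; last by move=> y _; rewrite lee_fin powR_ge0.
rewrite ge0_integralZl_EFin ?powR_ge0// -/J JE -EFinM.
rewrite /local_kernel layer_fubini//.
set W := (\int[_]_(t in _) _)%E.
have WC : (W * (profile x `^ p)%:E <= (A `^ p * C)%:E)%E.
  by apply: cond_ii_wolff; rewrite le_max lexx ?orbT.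
(* Since h^q = h h^p, the bound on [W] absorbs h^p and leaves one factor h. *)
have : (((A * profile x) `^ q)%:E * W <= (A `^ q * profile x * (A `^ p * C))%:E)%E.
  rewrite (powRM _ (ltW A_gt0) (ltW hx0)) -(mulr_powRB1 (ltW hx0) q_gt0) -/p mulrA.
  rewrite EFinM [leRHS]EFinM -muleA; apply: lee_wpmul2l.
    by rewrite lee_fin mulr_ge0 ?powR_ge0// ltW.
  by rewrite muleC.
move=> h; apply: le_trans (leeD2l _ h) _; rewrite -EFinD lee_fin.
have alg (a b c' j z : R) : 0 <= z -> a * z * j + b * z * c' <= (a * j + b * c' + 1) * z.
  move=> z0; rewrite -subr_ge0.
  by have -> : (a * j + b * c' + 1) * z - (a * z * j + b * z * c') = z by ring.
by apply: alg; exact: ltW.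
Qed.

End sufficiency.

(** * Regularity of doubling measures *)

Section doubling_measures.
Context {R : realType} {M : completeMetricType R}.
Variable mu : {measure set (borel M) -> \bar R}.
Local Open Scope ereal_scope.

(** The inverse of 0 is +oo by convention, so the integrand is constantly +oo. *)
Lemma tail_null_ball (x : M) (d : R) : (0 < d)%R ->
  (forall t, (0 < t)%R -> mu (ball x t) = 0) -> tail mu x d = +oo.
Proof.
move=> d0 mu0; rewrite /tail (eq_integral (cst +oo)).
  by rewrite integral_cst//= lebesgue_measure_itv/= ltry addye// mulyy.
move=> t; rewrite inE/= in_itv/= andbT => dt; have t0 := lt_trans d0 dt.
by rewrite mu0// inve0 gt0_muley// lte_fin.
Qed.

Lemma tail_infinite_ball (x : M) (d : R) : (0 < d)%R ->
  (forall t, (0 < t)%R -> mu (ball x t) = +oo) -> tail mu x d = 0.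
Proof.
move=> d0 muoo; rewrite /tail integral0_eq// => t /=; rewrite in_itv/= andbT => dt.
by rewrite muoo ?(lt_trans d0 dt)// invey mule0.
Qed.

Variable D : R.
Hypotheses (D_gt0 : (0 < D)%R) (doubling : forall (x : M) (r : R), (0 < r)%R ->
  mu (ball x (2 * r)%R) <= D%:E * mu (ball x r)).

Lemma doubling_expn k (x : M) (r : R) : (0 < r)%R ->
  mu (ball x (2 ^+ k * r)%R) <= (D ^+ k)%:E * mu (ball x r).
Proof.
move=> r0; elim: k => [|k IH]; first by rewrite !expr0 mul1r mul1e.
rewrite exprS -mulrA; apply: le_trans (doubling x _) _; first by rewrite mulr_gt0// exprn_gt0.
by rewrite exprS EFinM -muleA; apply: lee_wpmul2l => //; rewrite lee_fin ltW.
Qed.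

Lemma doubling_le (x : M) (r t : R) : (0 < r)%R ->
  exists2 c : R, (0 < c)%R & mu (ball x t) <= c%:E * mu (ball x r).
Proof.
move=> r0; pose k := (Num.truncn (t / r)).+1; exists (D ^+ k)%R; first by rewrite exprn_gt0.
apply: le_trans (doubling_expn k x r0); rewrite le_measure ?inE//; [exact: ball_borel..|].
apply: le_ball; rewrite -ler_pdivrMr// (@le_trans _ _ k%:R)//; first exact/ltW/truncnS_gt.
by rewrite -natrX ler_nat ltnW// ltn_expl.
Qed.

(** By doubling, if one ball had measure 0 or +oo, all concentric balls would have the same measure,
    and the tail would be +oo or 0 respectively. *)
Lemma regular_volumeW :
  (forall x, exists2 d : R, (0 < d)%R & 0 < tail mu x d < +oo) -> regular_volume mu D.
Proof.
move=> h; split => //; last by move=> x; have [d d0 /andP[_ dfin]] := h x; exists d.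
move=> x r r0; have [d d0 /andP[tail0 tailoo]] := h x; apply/andP; split.
  rewrite lt0e measure_ge0 andbT; apply/eqP => mur.
  suff : tail mu x d = +oo by move=> e; rewrite e ltxx in tailoo.
  apply: tail_null_ball => // t t0; have [c c0] := doubling_le x t r0.
  by rewrite mur mule0 measure_le0 => /eqP.
rewrite ltNge leye_eq; apply/eqP => mur.
suff : tail mu x d = 0 by move=> e; rewrite e ltxx in tail0.
apply: tail_infinite_ball => // t t0; have [c c0] := doubling_le x r t0.
have : 0 <= mu (ball x t) by [].
by rewrite mur leye_eq; case: (mu (ball x t)).
Qed.

End doubling_measures.

(** * Transfer between the radial kernel and the Green function *)

Section green_comparison.
Context {R : realType} {M : completeMetricType R}.
Variables (mu sigma : {measure set (borel M) -> \bar R}) (D : R).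
Hypothesis mu_regular : regular_volume mu D.
Variables (G : M -> M -> \bar R) (q c1 c2 : R).
Hypotheses (q_gt1 : 1 < q) (c1_gt0 : 0 < c1) (c2_gt0 : 0 < c2).
Hypothesis G_tail : forall x y, (c1%:E * tail mu x (mdist x y) <= G x y /\
  G x y <= c2%:E * tail mu x (mdist x y))%E.

(** The bound G >= c1 tail makes [u] a supersolution for the radial kernel; lower semicontinuity
    supplies its Borel measurability. *)
Lemma positive_solution_necessary u : positive_solution G sigma q u ->
  forall (o : M) (r0 : R), 0 < r0 -> condition_i mu sigma q o r0 /\
    exists2 C : R, 0 < C & condition_ii mu sigma q o r0 C.
Proof.
move=> [u_gt0 u_lsc u_super] o r0 r0_gt0.
have mu_ : measurable_fun [set: borel M] (u : borel M -> R).
  by apply/measurable_EFinP; exact: lower_semicontinuous_borel u_lsc.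
have u_tail x : (c1%:E * \int[sigma]_(y in [set: borel M])
    (tail mu x (mdist x y) * (u y `^ q)%:E) <= (u x)%:E)%E.
  have tail0 y : (0 <= tail mu x (mdist x y))%E by rewrite (tail_ge0 mu_regular)// mdist_ge0.
  have up0 y : (0 <= (u y `^ q)%:E)%E by rewrite lee_fin powR_ge0.
  apply: le_trans (u_super x); rewrite -ge0_integralZl_EFin ?(ltW c1_gt0)//; last 2 first.
  - by move=> y _; rewrite mule_ge0.
  - apply: emeasurable_funM; first exact: (tail_mdist_measurable mu_regular).
    by apply/measurable_EFinP; exact: (measurableT_comp (measurable_powR q) mu_).
  apply: ge0_le_integral_any => y _; first by rewrite !mule_ge0// lee_fin ltW.
  by rewrite muleA; apply: lee_wpmul2r => //; case: (G_tail x y).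
split; first exact: (necessity_i mu_regular q_gt1 c1_gt0 u_gt0 mu_ u_tail).
exact: (necessity_ii mu_regular q_gt1 c1_gt0 u_gt0 mu_ u_tail).
Qed.

Lemma conditions_sufficient (o : M) (r0 C : R) : 0 < r0 ->
  continuous (G ^~ o) -> condition_i mu sigma q o r0 ->
  condition_ii mu sigma q o r0 C ->
  exists u, positive_solution G sigma q u.
Proof.
move=> r0_gt0 G_cont ci cii.
(* [g] is comparable to [h] and takes its lower semicontinuity from the continuity of [G ^~ o]; the
   cap 1 keeps it finite where G is infinite. *)
pose h := profile mu o r0; pose g y := fine (Order.min 1%E (G y o)).
have [K K0 hK] := kernel_profile_bound mu_regular q_gt1 r0_gt0 ci cii.
have D0 : 0 < D by case: mu_regular.
have h0 y : 0 < h y by exact: (profile_gt0 mu_regular).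
have tail0 x y : (0 <= tail mu x (mdist x y))%E by rewrite (tail_ge0 mu_regular)// mdist_ge0.
have G0 x y : (0 <= G x y)%E.
  by case: (G_tail x y) => + _; apply: le_trans; rewrite mule_ge0// lee_fin ltW.
have gE y : (g y)%:E = Order.min 1%E (G y o).
  rewrite /g fineK// ge0_fin_numE ?le_min ?lee01 ?G0//.
  by rewrite gt_min ltry.
have t0 := rtail_gt0 mu_regular o r0_gt0.
have mx y : 0 < Num.max (mdist o y) r0 by rewrite lt_max r0_gt0 orbT.
have hr y : h y <= real_tail mu o r0.
  by apply: (rtail_nonincreasing mu_regular) => //; rewrite le_max lexx orbT.
(* The second entry gives a h <= 1, as h is at most [rtail] at [r0]; the first gives a h <= G(., o),
   after a change of centre from o to y. *)
pose a := Num.min (c1 / D) (real_tail mu o r0)^-1.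
have a0 : 0 < a by rewrite lt_min divr_gt0//= invr_gt0.
have gh y : a * h y <= g y.
  rewrite -lee_fin gE le_min; apply/andP; split.
    rewrite lee_fin (@le_trans _ _ ((real_tail mu o r0)^-1 * h y))//.
      by apply: ler_wpM2r; [exact: ltW|rewrite ge_min lexx orbT].
    by rewrite mulrC ler_pdivrMr// mul1r.
  apply: le_trans (proj1 (G_tail y o)).
  apply: (@le_trans _ _ (c1 * real_tail mu y (Num.max (mdist o y) r0))%:E).
    rewrite lee_fin (@le_trans _ _ (c1 / D * h y))//.
      by apply: ler_wpM2r; [exact: ltW|rewrite ge_min lexx].
    rewrite -mulrA; apply: ler_wpM2l; first exact: ltW.
    rewrite mulrC ler_pdivrMr// mulrC; apply: (rtail_center mu_regular) => //.
    by rewrite le_max lexx.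
  rewrite EFinM; apply: lee_wpmul2l; first by rewrite lee_fin ltW.
  rewrite -(rtailE mu_regular)//; apply: (tail_nonincreasing mu_regular).
    exact: mdist_ge0.
  by rewrite metric_sym le_max lexx.
(* The first summand serves when d(o, y) >= r0, the second when y is closer to o and the cap 1 is
   used. *)
pose b := c2 * D + (real_tail mu o r0)^-1.
have b0 : 0 < b by rewrite addr_gt0 ?mulr_gt0 ?invr_gt0.
have gb y : g y <= b * h y.
  have [far|near] := leP r0 (mdist o y).
    have d0 := lt_le_trans r0_gt0 far.
    have hE : h y = real_tail mu o (mdist o y) by rewrite /h /profile max_l.
    rewrite -lee_fin gE ge_min; apply/orP; right.
    apply: le_trans (proj2 (G_tail y o)) _.
    rewrite (rtailE mu_regular) ?[mdist y o]metric_sym// -EFinM lee_fin.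
    apply: (@le_trans _ _ (c2 * D * h y)).
      rewrite -mulrA; apply: ler_wpM2l; first exact: ltW.
      by rewrite hE; apply: (rtail_center mu_regular) => //; rewrite metric_sym.
    by apply: ler_wpM2r; rewrite ?lerDl ?invr_ge0 ltW.
  have hE : h y = real_tail mu o r0 by rewrite /h /profile max_r// ltW.
  rewrite -lee_fin gE ge_min; apply/orP; left; rewrite lee_fin.
  rewrite /b mulrDl hE mulVf ?gt_eqF// lerDr.
  by rewrite !mulr_ge0// ltW.
(* The integral of G g^q is at most c2 b^q K h <= L g, so e g is a solution once e^q L = e, that is,
   e = L^(-1/(q-1)). *)
pose L := c2 * b `^ q * K / a.
have L0 : 0 < L by rewrite divr_gt0// !mulr_gt0// powR_gt0.
have p0 : 0 < q - 1 by rewrite subr_gt0.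
pose e := L `^ (- (q - 1)^-1).
have e0 : 0 < e by exact: powR_gt0.
have eq : e `^ q * L = e.
  rewrite -(mulr_powRB1 (ltW e0) (lt_trans ltr01 q_gt1)) {2}/e -powRrM.
  by rewrite mulNr mulVf ?gt_eqF// powR_inv1 ?(ltW L0)// divfK ?gt_eqF.
have g0 y : 0 < g y by rewrite (lt_le_trans _ (gh y))// mulr_gt0.
exists (fun y => e * g y); split => [y||x].
- by rewrite mulr_gt0.
- apply/lower_semicontinuousP => s.
  (* A superlevel set of e g is empty when s / e >= 1, as g <= 1, and otherwise is a superlevel set
     of [G ^~ o]. *)
  have [s1|s1] := ltP (s / e) 1; last first.
    rewrite (_ : mkset _ = set0); first exact: open0.
    apply/seteqP; split => // y /=; rewrite lte_fin mulrC -ltr_pdivrMr//.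
    rewrite ltNge => /negP; apply; apply: le_trans s1.
    by rewrite -lee_fin gE ge_min lexx.
  rewrite (_ : mkset _ = (G ^~ o) @^-1` [set z | (s / e)%:E < z]%E).
    by apply: open_comp; [move=> y _; exact: G_cont|exact: open_ereal_gt_ereal].
  have gt_s y : (s%:E < (e * g y)%:E)%E = ((s / e)%:E < G y o)%E.
    by rewrite lte_fin mulrC -ltr_pdivrMr// -lte_fin gE lt_min lte_fin s1.
  by apply/seteqP; split => y /=; rewrite gt_s.
- have -> : (e * g x)%:E = ((e `^ q * c2 * b `^ q * K / a * g x)%:E).
    by rewrite -{1}eq /L; congr (_ * _)%:E; rewrite !mulrA.
  have ux : ((e `^ q * c2 * b `^ q)%:E * (K * h x)%:E <=
      (e `^ q * c2 * b `^ q * K / a * g x)%:E)%E.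
    rewrite -EFinM lee_fin -!mulrA; do 3 (apply: ler_wpM2l; first by rewrite ?powR_ge0 ?ltW).
    apply: ler_wpM2l; first exact: ltW.
    by rewrite mulrC ler_pdivlMr// mulrC.
  apply: le_trans ux.
  apply: le_trans (lee_wpmul2l _ (hK x)); last by rewrite lee_fin !mulr_ge0 ?powR_ge0// ltW.
  have hp0 y : (0 <= (h y `^ q)%:E)%E by rewrite lee_fin powR_ge0.
  rewrite -ge0_integralZl_EFin//; last 3 first.
  + by move=> y _; rewrite mule_ge0.
  + apply: emeasurable_funM; first exact: (tail_mdist_measurable mu_regular).
    apply/measurable_EFinP; apply: (measurableT_comp (measurable_powR q)).
    exact: (profile_measurable mu_regular).
  + by rewrite !mulr_ge0 ?powR_ge0// ltW.
  apply: ge0_le_integral_any => y _; first by rewrite mule_ge0// lee_fin powR_ge0.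
  apply: (@le_trans _ _ ((c2%:E * tail mu x (mdist x y)) * (e `^ q * (b `^ q * h y `^ q))%:E)%E).
    apply: lee_pmul => //; first by rewrite lee_fin powR_ge0.
      by case: (G_tail x y).
    rewrite lee_fin -(powRM _ (ltW b0) (ltW (h0 y))) -powRM ?mulr_ge0 ?(ltW e0) ?(ltW b0) ?(ltW (h0 y))//.
    apply: le_powR2r; first by rewrite ltW// (lt_trans ltr01).
      by apply: mulr_ge0; exact: ltW.
    by apply: ler_wpM2l; [exact: ltW|exact: gb].
  rewrite le_eqVlt; apply/orP; left; apply/eqP.
  have alg (v w s r z : \bar R) : (v * w * (s * (r * z)) = s * v * r * (w * z))%E.
    by rewrite [LHS]muleC (muleA s) muleACA (muleAC s) (muleC z).
  by rewrite !EFinM alg.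
Qed.

End green_comparison.

(** * The equivalence on the manifold *)

Theorem theorem1p1 (R : realType) (n : nat) (M : completeMetricType R)
  (g : riemannian n M)
  (M_second_countable : second_countable (T := M))
  (M_connected : connected [set: M])
  (M_distance : geodesic_distance g)
  (M_noncompact : ~ compact [set: M])
  (mu : {measure set (borel M) -> \bar R})
  (mu_riemannian : riemannian_measure g mu)
  (M_nonparabolic : non_parabolic g mu)
  (G : M -> M -> \bar R)
  (G_minimal : minimal_green_function g mu G)
  (q : R) (q_gt1 : 1 < q)
  (sigma : {measure set (borel M) -> \bar R})
  (sigma_radon : radon sigma)
  (mu_doubling : volume_doubling mu)
  (G_estimate : green_estimate mu G) :
  ((exists u : M -> R, positive_solution G sigma q u) <->
   (exists (o : M) (r0 C : R), [/\ 0 < r0, 0 < C,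
      condition_i mu sigma q o r0 & condition_ii mu sigma q o r0 C]))
  /\
  ((exists u : M -> R, positive_solution G sigma q u) ->
   forall (o : M) (r0 : R), 0 < r0 ->
     condition_i mu sigma q o r0 /\
     exists2 C : R, 0 < C & condition_ii mu sigma q o r0 C).
Proof.
have [D D0 doubling] := mu_doubling.
have [c1 [c2 [c10 c20 G_tail]]] := G_estimate.
have [G_green _] := G_minimal.
(* A one-point space would be compact. *)
have other x : exists y : M, x != y.
  apply/not_existsP => h; apply: M_noncompact.
  rewrite (_ : [set: M] = [set x]); first exact: compact_set1.
  by apply/seteqP; split => // y _ /=; apply/esym/eqP/negPn/negP; exact: h.
(* Off the diagonal G is positive and finite, hence so is the tail at radius d(x, y) by the
   two-sided estimate. *)
have mu_regular : regular_volume mu D.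
  apply: regular_volumeW => // x; have [y xy] := other x.
  exists (mdist x y); first by rewrite mdist_gt0.
  have [G0 Goo _ _ _] := G_green y; have [t1 t2] := G_tail x y.
  apply/andP; split.
    rewrite ltNge; apply/negP => t0; have := lt_le_trans (G0 x) t2.
    by rewrite ltNge mule_ge0_le0// lee_fin ltW.
  rewrite ltNge leye_eq; apply/eqP => t0; have := Goo x xy.
  by rewrite ltNge (le_trans _ t1)// t0 gt0_muley ?lte_fin.
have necessary := positive_solution_necessary (sigma := sigma) mu_regular q_gt1 c10 G_tail.
split; last by move=> [u /necessary].
split=> [[u /necessary nec] | [ o [r0 [C [r00 _ ci cii]]]]].
  have [ci [C C0 cii]] := nec point 1 ltr01.
  by exists point, 1, C; split.
apply: (conditions_sufficient mu_regular q_gt1 c10 c20 G_tail r00 _ ci cii).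
by have [] := G_green o.
Qed.
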